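(* Let $M$ be a dual operator system, let $\phi:M\to M$ be a UP map, and let $M_\infty=\bigcup_{r>0}\bigcap_{n=1}^\infty\phi^n(\mathrm{ball}_r M)$. The following are equivalent: (i) The asymptotic lift of $\phi:M\to M$ embeds in $M$. (ii) $M_\infty$ is weak$^*$-closed and $\phi$ restricts to an order automorphism of $M_\infty$. (iii) The asymptotic lift of $\phi:M\to M$ is isomorphic to the triple $(M_\infty,\phi\restriction_{M_\infty},\iota)$, where $\iota:M_\infty\subseteq M$ is the inclusion map.
   Context: A dual operator system is a self-adjoint ($M^*=M$) linear space of operators $M\subseteq\mathcal B(H)$ on a Hilbert space $H$ that contains the identity $\mathbf 1$ and is closed in the weak$^*$ (ultraweak) topology of $\mathcal B(H)$; its predual $M_*$ is identified with the weak$^*$-continuous linear functionals on $M$. A linear map between dual operator systems is normal if it is weak$^*$-continuous. A UP map is a normal, unit-preserving, positive linear map between dual operator systems. A UP-isomorphism is a bijective UP map whose inverse is a UP map; a UP automorphism is a UP-isomorphism of a dual operator system onto itself. $M^{\rm sa}$ denotes the real Banach space of self-adjoint elements of $M$, and $\mathrm{ball}_r X$ denotes the closed ball of radius $r$ (centered at $0$) of a normed space $X$. A reversible lift of a UP map $\phi:M\to M$ is a triple $(N,\alpha,E)$ consisting of a dual operator system $N$, a UP automorphism $\alpha:N\to N$, and a UP map $E:N\to M$ satisfying $E\circ\alpha=\phi\circ E$. It is nondegenerate if, for $y\in N$, $E(\alpha^{-n}(y))=0$ for all $n=0,1,2,\dots$ implies $y=0$. An asymptotic lift of $\phi$ is a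 nondegenerate reversible lift $(N,\alpha,E)$ such that $\|\rho\circ E\restriction_{N^{\rm sa}}\|=\lim_{k\to\infty}\|\rho\circ\phi^k\restriction_{M^{\rm sa}}\|$ for every $\rho\in M_*$. Every UP map has an asymptotic lift, unique up to isomorphism, where triples $(N_1,\alpha_1,E_1)$ and $(N_2,\alpha_2,E_2)$ are isomorphic if there is a UP-isomorphism $\theta:N_1\to N_2$ with $\theta\circ\alpha_1=\alpha_2\circ\theta$ and $E_2\circ\theta=E_1$. (Statement (iii) includes the assertion that $(M_\infty,\phi\restriction_{M_\infty},\iota)$ is such a triple, so that $M_\infty$ is a dual operator system.) The asymptotic lift $(N,\alpha,E)$ embeds in $M$ if $\|E(y)\|=\|y\|$ for every $y=y^*\in N$ (this does not depend on the choice of asymptotic lift). The set $M_\infty$, called the tail operator system, is a self-adjoint linear subspace of $M$ containing $\mathbf 1$ with $\phi(M_\infty)=M_\infty$. An order automorphism of an operator system is a unit-preserving linear bijection of it onto itself that is positive and has positive inverse. *)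

(* Defs.v *)
From HB Require Import structures.
From mathcomp Require Import all_boot all_order all_algebra.
From mathcomp Require Import complex.
From mathcomp Require Import all_classical all_reals all_analysis.

Set Implicit Arguments.
Unset Strict Implicit.
Unset Printing Implicit Defensive.

Import Order.TTheory GRing.Theory Num.Theory.
Import numFieldNormedType.Exports.

Local Open Scope classical_set_scope.
Local Open Scope ring_scope.

(** Complex Hilbert spaces.  [{dot H for conj}] is linear in its first argument
    and conjugate-linear in the second. *)
HB.mixin Record CompleteNormedModule_isHilbert (R : realType) H
    & CompleteNormedModule R[i] H := {
  hdot : {dot H for @Num.conj R[i]} ;
  hdotE : forall u : H, hdot u u = `|u| ^+ 2
}.

#[short(type="hilbertType")]
HB.structure Definition Hilbert (R : realType) :=
  { H of CompleteNormedModule_isHilbert R H & CompleteNormedModule R[i] H }.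

(** Norms of normed spaces over [R[i]] take values in [R[i]]; [rnorm] is the
    same (real) number in [R]. *)
Definition rnorm {R : realType} {V : normedModType R[i]} (v : V) : R :=
  complex.Re `|v|.

Section BoundedOperators.
Context {R : realType} (H : hilbertType R).

Definition bounded_op : {pred H -> H} :=
  [pred x : H -> H | `[< linear x /\ continuous x >]].

Record bop := Bop { bop_fun :> H -> H; bop_funP : bop_fun \in bounded_op }.

HB.instance Definition _ := [isSub for bop_fun].
HB.instance Definition _ := gen_eqMixin bop.
HB.instance Definition _ := gen_choiceMixin bop.

Lemma bounded_op_submod_closed : submod_closed bounded_op.
Proof.
split.
  apply/asboolP; split => [a u v|u]; last exact: cvg_cst.
  by rewrite /= scaler0 addr0.
move=> a x y /asboolP[lx cx] /asboolP[ly cy]; apply/asboolP; split.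
  move=> b u v; rewrite /= !fctE lx ly !scalerDr !scalerA (mulrC a b).
  by rewrite addrACA.
move=> u; apply: cvgD; last exact: cy.
by apply: cvgZl_tmp; exact: cx.
Qed.

HB.instance Definition _ :=
  GRing.isSubmodClosed.Build R[i] (H -> H) bounded_op bounded_op_submod_closed.
HB.instance Definition _ := [SubChoice_isSubLmodule of bop by <:].

Lemma bounded_op_id : idfun \in bounded_op.
Proof. by apply/asboolP; split => // u; exact: cvg_id. Qed.

Definition opid : bop := Bop bounded_op_id.

Definition opnorm (x : bop) : R :=
  sup [set rnorm (x u) | u in [set u : H | rnorm u <= 1]].

Definition is_adjoint (x y : bop) := forall u v : H, hdot (x u) v = hdot u (y v).

Definition selfadjoint : set bop := [set x | is_adjoint x x].

Definition op_ge0 (x : bop) := forall u : H, 0 <= hdot (x u) u.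

(** The ultraweak topology is the coarsest one that makes continuous all the
    functionals [x |-> \sum_n <x u_n, v_n>] with [u] and [v] square-summable. *)
Definition square_summable : set (nat -> H) :=
  [set u | cvgn (series (fun n => rnorm (u n) ^+ 2))].

Definition uw_functional (u v : nat -> H) (x : bop) : R[i]^o :=
  limn (series (fun n => hdot (x (u n)) (v n) : R[i]^o)).

Definition ultraweak_topology :=
  sup_topology (fun uv : square_summable * square_summable =>
    Topological.on (initial_topology (uw_functional (val uv.1) (val uv.2)))).

HB.instance Definition _ := Topological.copy bop ultraweak_topology.

End BoundedOperators.

Arguments selfadjoint {R} H _.

Notation "''B' ( H )" := (bop H) (at level 8, format "''B' ( H )").

Definition dual_operator_system {R : realType} {H : hilbertType R}
    (M : set 'B(H)) :=
  [/\ forall (a : R[i]) x y, M x -> M y -> M (a *: x + y),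
      forall x, M x -> exists2 y, M y & is_adjoint x y,
      M (opid H) &
      closed M].

Section Maps.
Context {R : realType}.
Implicit Types H K L : hilbertType R.

(** Maps between operator systems [M] and [N] are total functions on the ambient
    ['B(_)]; only their restrictions to [M] are constrained or ever used. *)
Definition linear_on {H} {V : lmodType R[i]} (M : set 'B(H)) (f : 'B(H) -> V) :=
  forall (a : R[i]) x y, M x -> M y -> f (a *: x + y) = a *: f x + f y.

Definition unital_positive {H K} (M : set 'B(H)) (N : set 'B(K))
    (f : 'B(H) -> 'B(K)) :=
  [/\ set_fun M N f, linear_on M f, f (opid H) = opid K &
      forall x, M x -> op_ge0 x -> op_ge0 (f x)].

Definition UP_map {H K} (M : set 'B(H)) (N : set 'B(K)) (f : 'B(H) -> 'B(K)) :=
  unital_positive M N f /\ {within M, continuous f}.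

Definition inv_on {H K} (M : set 'B(H)) (f : 'B(H) -> 'B(K)) : 'B(K) -> 'B(H) :=
  'pinv_(fun=> 0) M f.

Definition UP_isomorphism {H K} (M : set 'B(H)) (N : set 'B(K))
    (f : 'B(H) -> 'B(K)) :=
  [/\ UP_map M N f, set_bij M N f & UP_map N M (inv_on M f)].

Definition UP_automorphism {H} (M : set 'B(H)) (f : 'B(H) -> 'B(H)) :=
  UP_isomorphism M M f.

Definition order_automorphism {H} (S : set 'B(H)) (f : 'B(H) -> 'B(H)) :=
  [/\ unital_positive S S f, set_bij S S f & unital_positive S S (inv_on S f)].

Definition predual {H} (M : set 'B(H)) : set ('B(H) -> R[i]^o) :=
  [set rho : 'B(H) -> R[i]^o | linear_on M rho /\ {within M, continuous rho}].

(** The norm of the restriction of [rho] to the self-adjoint part of [M]. *)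
Definition sa_norm {H} (M : set 'B(H)) (rho : 'B(H) -> R[i]^o) : R :=
  sup [set rnorm (rho x) | x in M `&` selfadjoint H `&` [set x | opnorm x <= 1]].

Definition ball_of {H} (M : set 'B(H)) (r : R) : set 'B(H) :=
  M `&` [set x | opnorm x <= r].

Definition tail_system {H} (M : set 'B(H)) (phi : 'B(H) -> 'B(H)) : set 'B(H) :=
  \bigcup_(r in [set r : R | 0 < r])
    \bigcap_(n in [set n : nat | (1 <= n)%N]) (iter n phi @` ball_of M r).

Definition reversible_lift {H K} (M : set 'B(H)) (phi : 'B(H) -> 'B(H))
    (N : set 'B(K)) (alpha : 'B(K) -> 'B(K)) (E : 'B(K) -> 'B(H)) :=
  [/\ dual_operator_system N, UP_automorphism N alpha, UP_map N M E &
      forall y, N y -> E (alpha y) = phi (E y)].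

Definition nondegenerate_lift {H K}
    (N : set 'B(K)) (alpha : 'B(K) -> 'B(K)) (E : 'B(K) -> 'B(H)) :=
  forall y, N y -> (forall n, E (iter n (inv_on N alpha) y) = 0) -> y = 0.

Definition asymptotic_lift {H K} (M : set 'B(H)) (phi : 'B(H) -> 'B(H))
    (N : set 'B(K)) (alpha : 'B(K) -> 'B(K)) (E : 'B(K) -> 'B(H)) :=
  [/\ reversible_lift M phi N alpha E,
      nondegenerate_lift N alpha E &
      forall rho, predual M rho ->
        (fun k => sa_norm M (rho \o iter k phi)) @ \oo --> sa_norm N (rho \o E)].

Definition isomorphic_triples {H K L}
    (N1 : set 'B(K)) (alpha1 : 'B(K) -> 'B(K)) (E1 : 'B(K) -> 'B(H))
    (N2 : set 'B(L)) (alpha2 : 'B(L) -> 'B(L)) (E2 : 'B(L) -> 'B(H)) :=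
  exists theta : 'B(K) -> 'B(L),
    [/\ UP_isomorphism N1 N2 theta,
        forall y, N1 y -> theta (alpha1 y) = alpha2 (theta y) &
        forall y, N1 y -> E2 (theta y) = E1 y].

Definition embeds {H K} (N : set 'B(K)) (E : 'B(K) -> 'B(H)) :=
  forall y, N y -> selfadjoint K y -> opnorm (E y) = opnorm y.

End Maps.

(* Main.v *)
From HB Require Import structures.
Require Import Defs.
From mathcomp Require Import all_boot all_order all_algebra.
From mathcomp Require Import complex ring lra.
From mathcomp Require Import all_classical all_reals all_analysis.

(** Each selfadjoint [y] in [N] satisfies [E y = phi^n (E (alpha^-n y))], so
    [E] maps the ball of radius [r] of [N^sa] into all the sets [phi^n (ball_r
    M^sa)]. These images are ultraweakly compact and convex, and the norm
    condition of an asymptotic lift compares their support functions: a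
    selfadjoint point of [\bigcap_n phi^n (ball_r M^sa)] outside [E (ball_r
    N^sa)] could be separated from the latter by a normal functional [rho],
    against [||rho \o E|| = lim ||rho \o phi^k||]. Hence the two sets agree
    ([tail_sa_in_range]) and [E] maps [N] onto the tail ([tail_systemE]).

    Suppose that [E] is isometric on selfadjoint elements. Then [E] is
    injective and reflects positivity, since [0 <= y <= r] means that [y] and
    [r - y] are selfadjoint of norm at most [r]; so [phi = E \o alpha \o E^-1]
    on the tail is an order automorphism. Conversely, if [phi] is an order
    automorphism of the tail, it is isometric there on selfadjoint elements; a
    selfadjoint tail element of norm at most [r] is then in every [phi^n
    (ball_r M^sa)], so it is the image of an element of norm at most [r] of
    [N], and nondegeneracy makes this preimage unique
    ([order_automorphism_expanding]).

    What is left is analysis: a normal isometry on [N^sa] has an ultraweakly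
    closed range ([closed_range]) and a normal inverse
    ([continuous_range_inv]). This is applied to [E], and also to [phi] on the
    closed tail. The point is that each normal functional [g] on [N^sa]
    factors as [sigma \o E] with [sigma] normal ([lift_functional]). A minimax
    argument over the compact unit ball of [N^sa] gives a finite sum [sigma_0]
    of vector functionals, of norm at most [||g||], such that [||g - sigma_0
    \o E|| <= ||g|| / 2] ([lift_step]); repeating this on the differences and
    laying the finite sums end to end, one obtains [sigma]
    ([concat_functional]).

    Everything takes place over the reals: the real inner product [Re <u, v>]
    determines the topology, and an operator is a combination of its
    selfadjoint real and imaginary parts. *)

Set Implicit Arguments.
Unset Strict Implicit.
Unset Printing Implicit Defensive.

Import Order.TTheory GRing.Theory Num.Theory.
Import numFieldNormedType.Exports.

Local Open Scope classical_set_scope.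
Local Open Scope ring_scope.
Local Open Scope complex_scope.

(** * The real inner product of a complex Hilbert space *)
Section Hilbert.
Context {R : realType} {H : hilbertType R}.
Implicit Types (u v w : H) (a : R[i]) (r : R).

(** The full inner product is recovered from its real part by [hdot_ip]. *)
Definition ip u v : R := complex.Re (hdot u v).

Lemma rnormE v : `|v| = (rnorm v)%:C.
Proof. by rewrite /rnorm RRe_real // normr_real. Qed.

Lemma rnorm_ge0 v : 0 <= rnorm v.
Proof. by rewrite -lecR -rnormE normr_ge0. Qed.

Lemma rnorm0 : rnorm (0 : H) = 0.
Proof. by rewrite /rnorm normr0. Qed.

Lemma rnorm_eq0 v : rnorm v = 0 -> v = 0.
Proof. by move=> v0; apply/eqP; rewrite -normr_eq0 rnormE v0. Qed.

Lemma rnormD u v : rnorm (u + v) <= rnorm u + rnorm v.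
Proof. by rewrite -lecR rmorphD /= -!rnormE ler_normD. Qed.

Lemma rnormN v : rnorm (- v) = rnorm v.
Proof. by rewrite /rnorm normrN. Qed.

Lemma rnormZ r v : rnorm (r%:C *: v) = `|r| * rnorm v.
Proof.
apply: (@complexI R); rewrite -rnormE normrZ rmorphM /= -rnormE.
by rewrite normc_def /= expr0n addr0 sqrtr_sqr.
Qed.

Lemma rnormi v : rnorm ('i *: v) = rnorm v.
Proof.
apply: (@complexI R); rewrite -!rnormE normrZ normc_def /=.
by rewrite expr0n expr1n add0r sqrtr1 mul1r.
Qed.

Lemma hdotC u v : hdot u v = (hdot v u)^*.
Proof. by rewrite (@hermC _ _ _ _ (@hdot R H)) expr0 mul1r. Qed.

Lemma ipC u v : ip u v = ip v u.
Proof. by rewrite /ip hdotC; case: (hdot v u). Qed.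

Lemma ipDl u v w : ip (u + v) w = ip u w + ip v w.
Proof. by rewrite /ip linearDl /=; case: (hdot u w) (hdot v w) => ? ? []. Qed.

Lemma ipDr u v w : ip w (u + v) = ip w u + ip w v.
Proof. by rewrite !(ipC w) ipDl. Qed.

Lemma ipJ a u v : ip (a *: u) v = ip u (a^* *: v).
Proof.
rewrite /ip linearZl_LR linearZr_LR /= -[Num.conj _]/(a^*^*) conjcK.
by rewrite mulrC.
Qed.

Lemma ipZl r u v : ip (r%:C *: u) v = r * ip u v.
Proof.
by rewrite /ip linearZl_LR /=; case: (hdot u v) => x y /=; rewrite mul0r subr0.
Qed.

Lemma ipZr r u v : ip u (r%:C *: v) = r * ip u v.
Proof. by rewrite ipC ipZl ipC. Qed.

Lemma ipNl u v : ip (- u) v = - ip u v.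
Proof. by rewrite -scaleN1r -(rmorphN1 (real_complex R)) ipZl mulN1r. Qed.

Lemma ipNr u v : ip u (- v) = - ip u v.
Proof. by rewrite ipC ipNl ipC. Qed.

Lemma ip0l v : ip 0 v = 0.
Proof. by rewrite -(scale0r v) -(rmorph0 (real_complex R)) ipZl mul0r. Qed.

Lemma ip0r v : ip v 0 = 0.
Proof. by rewrite ipC ip0l. Qed.

Lemma ipi u v : ip ('i *: u) v = - ip u ('i *: v).
Proof.
rewrite ipJ -ipNr -scaleNr; congr (ip u (_ *: v)).
by apply/eqP; rewrite eq_complex /= oppr0 !eqxx.
Qed.

Lemma ipii u v : ip ('i *: u) ('i *: v) = ip u v.
Proof. by rewrite ipi scalerA -expr2 sqr_i scaleN1r ipNr opprK. Qed.

Lemma ip_sq u : ip u u = rnorm u ^+ 2.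
Proof. by rewrite /ip hdotE rnormE -rmorphXn. Qed.

Lemma hdot_ip u v : hdot u v = ip u v +i* ip u ('i *: v).
Proof.
apply/eqP; rewrite eq_complex /= eqxx /= /ip linearZr_LR /=.
by case: (hdot u v) => x y /=; rewrite mul0r mulN1r opprK add0r.
Qed.

Lemma sq_rnormD u v :
  rnorm (u + v) ^+ 2 = rnorm u ^+ 2 + 2 * ip u v + rnorm v ^+ 2.
Proof. rewrite -!ip_sq !ipDl !ipDr (ipC v u); ring. Qed.

Lemma cauchy_schwarz u v : `|ip u v| <= rnorm u * rnorm v.
Proof.
suff le w z : ip w z <= rnorm w * rnorm z.
  by rewrite ler_norml le andbT lerNl -ipNl (le_trans (le _ _)) // rnormN.
have := rnorm_ge0 (w + z); have := rnormD w z => + h.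
move=> /(lerXn2r 2 (rnorm_ge0 (w + z)) (addr_ge0 (rnorm_ge0 w) (rnorm_ge0 z))).
by rewrite sq_rnormD; nra.
Qed.

Lemma ip_inj u v : (forall w, ip u w = ip v w) -> u = v.
Proof.
move=> uv; apply/subr0_eq/rnorm_eq0/eqP; rewrite -sqrf_eq0 -ip_sq.
by rewrite {1}[u - v]lock ipC -lock ipDl ipNl uv subrr.
Qed.

(** A symmetric form is controlled off the diagonal by its values on the
    diagonal, because [4 * ip (q u) v] is the difference of its values at [u +
    v] and at [u - v]. *)
Lemma polarization_bound (q : H -> H) c : linear q ->
    (forall u v, ip (q u) v = ip u (q v)) ->
    (forall u, `|ip (q u) u| <= c * rnorm u ^+ 2) ->
  forall u v, 2 * ip (q u) v <= c * (rnorm u ^+ 2 + rnorm v ^+ 2).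
Proof.
move=> ql qs qc u v.
have qD x y : q (x + y) = q x + q y by rewrite -[x]scale1r ql !scale1r.
have := qc (u + v); have := qc (u - v).
have qN x : q (- x) = - q x.
  apply/subr0_eq; rewrite opprK -qD addNr.
  by have := ql (-1) 0 0; rewrite scaler0 addr0 scaleN1r addNr.
rewrite !qD qN !ipDl !ipDr !ipNl !ipNr !sq_rnormD rnormN ipNr !ler_norml.
rewrite [ip (q v) u]ipC -qs => /andP[h1 h2] /andP[h3 h4]; lra.
Qed.

End Hilbert.

(** * Norm, adjoint and order of bounded operators *)
Section Operators.
Context {R : realType} {H : hilbertType R}.
Implicit Types (x y z : 'B(H)) (u v w : H) (a : R[i]) (r : R).

Lemma bop_linear x : linear x.
Proof. by have /asboolP[] := bop_funP x. Qed.

Lemma bop_ext x y : (forall u, x u = y u) -> x = y.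
Proof. by move=> xy; apply: val_inj; apply/funext. Qed.

Lemma bopDE x y u : (x + y) u = x u + y u. Proof. by []. Qed.
Lemma bopZE a x u : (a *: x) u = a *: x u. Proof. by []. Qed.
Lemma bopNE x u : (- x) u = - x u. Proof. by []. Qed.
Lemma bop0E u : (0 : 'B(H)) u = 0. Proof. by []. Qed.

Lemma bopD x u v : x (u + v) = x u + x v.
Proof. by rewrite -[u]scale1r bop_linear !scale1r. Qed.

Lemma bop0 x : x 0 = 0.
Proof. by have := bop_linear x (-1) 0 0;
  rewrite scaler0 addr0 scaleN1r addNr. Qed.

Lemma bopZ x a u : x (a *: u) = a *: x u.
Proof. by rewrite -[a *: u]addr0 bop_linear bop0 addr0. Qed.

Lemma bopN x u : x (- u) = - x u.
Proof. by rewrite -scaleN1r bopZ scaleN1r. Qed.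

Definition bounded_by r (q : H -> H) := forall u, rnorm (q u) <= r * rnorm u.

Lemma bounded_by_bop (q : H -> H) r :
  linear q -> bounded_by r q -> q \in bounded_op (H := H).
Proof.
move=> ql qr; apply/asboolP; split=> //.
pose Q := HB.pack_for {linear H -> H} q (GRing.isLinear.Build _ _ _ _ q ql).
have -> : q = Q by [].
apply/bounded_linear_continuous/linear_boundedP.
exists (`|r|%:C); split=> [|s rs u]; first by apply/complex_realP; exists `|r|.
rewrite [leLHS]rnormE [`|u|]rnormE; have := qr u; rewrite -lecR => /le_trans.
apply; rewrite rmorphM ler_wpM2r ?ler0c ?rnorm_ge0//.
by rewrite (le_trans _ (ltW rs))// lecR ler_norm.
Qed.

Lemma bop_bounded x : exists2 r, 0 <= r & bounded_by r x.
Proof.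
have /asboolP[xl xc] := bop_funP x.
pose Q := HB.pack_for {linear H -> H} (x : H -> H)
  (GRing.isLinear.Build _ _ _ _ (x : H -> H) xl).
have : bounded_near Q (nbhs (0 : H)) by apply: continuous_linear_bounded;
  apply: xc.
move=> /linear_boundedP[s [sr hs]].
exists (`|complex.Re s| + 1); first by rewrite addr_ge0.
move=> u; rewrite -lecR rmorphM /= -!rnormE; apply: hs.
rewrite -(RRe_real sr) ltcR; have := ler_norm (complex.Re s); lra.
Qed.

Lemma opnorm_ub x r : bounded_by r x ->
  ubound [set rnorm (x u) | u in [set u : H | rnorm u <= 1]] `|r|.
Proof.
move=> xr _ [u u1 <-]; apply: (le_trans (xr u)).
have := ler_norm r; have := normr_ge0 r; have := rnorm_ge0 u; move: u1 => /=;
  nra.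
Qed.

Lemma opnorm_bounds x : bounded_by (opnorm x) x.
Proof.
move=> u; have [u0|] := eqVneq (rnorm u) 0.
  by rewrite (rnorm_eq0 u0) bop0 rnorm0 mulr0.
rewrite neq_lt ltNge rnorm_ge0/= => u0.
rewrite -ler_pdivrMr//; have [r _ xr] := bop_bounded x.
apply: ub_le_sup; first by exists `|r|; exact: opnorm_ub.
exists ((rnorm u)^-1%:C *: u) => /=.
  by rewrite rnormZ ger0_norm ?invr_ge0 ?(ltW u0)// mulVf// lt0r_neq0.
by rewrite bopZ rnormZ ger0_norm ?invr_ge0 ?(ltW u0)// mulrC.
Qed.

Lemma opnormP x r : 0 <= r -> opnorm x <= r <-> bounded_by r x.
Proof.
move=> r0; split=> [xr u|xr].
  by apply: (le_trans (opnorm_bounds x u)); rewrite ler_wpM2r// rnorm_ge0.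
apply: ge_sup; last by rewrite -(ger0_norm r0); exact: opnorm_ub.
by exists (rnorm (x 0)), 0; rewrite //= rnorm0.
Qed.

Lemma opnorm_ge0 x : 0 <= opnorm x.
Proof.
have [r _ xr] := bop_bounded x.
apply: (le_trans (rnorm_ge0 (x 0))); apply: ub_le_sup.
  by exists `|r|; exact: opnorm_ub.
by exists 0; rewrite //= rnorm0.
Qed.

Lemma bounded_by_le r s (q : H -> H) :
  r <= s -> bounded_by r q -> bounded_by s q.
Proof.
by move=> rs qr u; apply: (le_trans (qr u)); rewrite ler_wpM2r ?rnorm_ge0.
Qed.

Lemma bounded_byD r s x y :
  bounded_by r x -> bounded_by s y -> bounded_by (r + s) (x + y).
Proof.
move=> xr ys u; rewrite bopDE (le_trans (rnormD _ _))// mulrDl lerD//.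
Qed.

Lemma bounded_byZ r c x : bounded_by r x -> bounded_by (`|c| * r) (c%:C *: x).
Proof. by move=> xr u; rewrite bopZE rnormZ -mulrA ler_wpM2l. Qed.

Lemma bounded_byi r x : bounded_by r x -> bounded_by r ('i *: x).
Proof. by move=> xr u; rewrite bopZE rnormi. Qed.

Lemma adjointP x y : is_adjoint x y <-> forall u v, ip (x u) v = ip u (y v).
Proof.
split=> [xy u v|xy u v]; first by rewrite /ip xy.
by rewrite !hdot_ip !xy -bopZ.
Qed.

Lemma adjoint_sym x y : is_adjoint x y -> is_adjoint y x.
Proof. by move=> /adjointP xy; apply/adjointP => u v; rewrite ipC -xy ipC. Qed.

Lemma adjoint_uniq x y z : is_adjoint x y -> is_adjoint x z -> y = z.
Proof.
move=> /adjointP xy /adjointP xz; apply: bop_ext => v; apply: ip_inj => w.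
by rewrite ipC -xy xz ipC.
Qed.

Lemma saP x : selfadjoint H x <-> forall u v, ip (x u) v = ip u (x v).
Proof. exact: adjointP. Qed.

Lemma sa0 : selfadjoint H 0.
Proof. by apply/saP => u v; rewrite bop0E ip0l ip0r. Qed.

Lemma saD x y : selfadjoint H x -> selfadjoint H y -> selfadjoint H (x + y).
Proof.
move=> /saP xs /saP ys; apply/saP => u v.
by rewrite !bopDE ipDl ipDr xs ys.
Qed.

Lemma saZ r x : selfadjoint H x -> selfadjoint H (r%:C *: x).
Proof. by move=> /saP xs; apply/saP => u v; rewrite !bopZE ipZl ipZr xs. Qed.

Lemma saN x : selfadjoint H x -> selfadjoint H (- x).
Proof. by move=> /saP xs; apply/saP => u v; rewrite !bopNE ipNl ipNr xs. Qed.

Lemma sa_opid : selfadjoint H (opid H).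
Proof. by apply/saP. Qed.

(** Real and imaginary parts of [x], to be used when [y] is the adjoint of
    [x]; the adjoint is an argument because it is only known through the
    relation [is_adjoint]. *)
Definition re_part x y : 'B(H) := (2^-1)%:C *: (x + y).
Definition im_part x y : 'B(H) := (2^-1)%:C *: ('i *: (y - x)).

Lemma re_part_sa x y : is_adjoint x y -> selfadjoint H (re_part x y).
Proof.
move=> xy; apply/saZ/saP => u v; have /adjointP yx := adjoint_sym xy.
by move/adjointP: xy => xy; rewrite !bopDE ipDl ipDr xy yx addrC.
Qed.

Lemma im_part_sa x y : is_adjoint x y -> selfadjoint H (im_part x y).
Proof.
move=> xy; apply/saZ/saP => u v; have /adjointP yx := adjoint_sym xy.
move/adjointP: xy => xy.
rewrite !bopZE ipi !bopDE !bopNE ipDl ipNl yx xy !bopZ scalerBr ipDr ipNr.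
by rewrite opprB addrC.
Qed.

Lemma re_im_part x y : x = re_part x y + 'i *: im_part x y.
Proof.
rewrite /re_part /im_part !scalerA mulrAC -expr2 sqr_i mulN1r scaleNr -scalerBr.
rewrite opprB addrACA subrr addr0 scalerDr -scalerDl -rmorphD /=.
have -> : 2^-1 + 2^-1 = 1 :> R by lra.
by rewrite scale1r.
Qed.

Lemma sa_imag0 x u : selfadjoint H x -> ip (x u) ('i *: u) = 0.
Proof.
move=> /saP xs; have : ip (x u) ('i *: u) = - ip (x u) ('i *: u).
  by rewrite {1}xs bopZ ipC ipi.
lra.
Qed.

(** A sesquilinear form that is real on the diagonal is hermitian. *)
Lemma op_ge0_sa x : op_ge0 x -> selfadjoint H x.
Proof.
move=> x0; have xi u : ip (x u) ('i *: u) = 0.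
  by have /ger0_Im := x0 u; rewrite hdot_ip.
apply/saP => u w; have := xi (u + - ('i *: w)).
rewrite bopD bopN !ipDl scalerDr !ipDr !ipNl !scalerN !ipNr.
rewrite !xi !bopZ !ipi !scalerA -!expr2 !sqr_i !scaleN1r !ipNr (ipC (x w)).
lra.
Qed.

Lemma op_ge0P x : selfadjoint H x -> op_ge0 x <-> forall u, 0 <= ip (x u) u.
Proof.
move=> xs; split=> x0 u; have := x0 u; rewrite hdot_ip sa_imag0// lecE /=.
  by rewrite eqxx.
by rewrite eqxx.
Qed.

Lemma op_ge0D x y : op_ge0 x -> op_ge0 y -> op_ge0 (x + y).
Proof. move=> x0 y0 u; rewrite bopDE linearDl; apply: addr_ge0;
  [exact: x0|exact: y0]. Qed.

Lemma op_ge0_scalar r : 0 <= r -> op_ge0 (r%:C *: opid H).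
Proof.
move=> r0; apply/op_ge0P; first by apply/saZ/sa_opid.
by move=> u; rewrite bopZE ipZl ip_sq mulr_ge0// sqr_ge0.
Qed.

(** The norm of a selfadjoint operator is its numerical radius: apply
    [polarization_bound] to [u] and to [x u] rescaled to the norm of [u]. *)
Lemma sa_bounded_byP x r : 0 <= r -> selfadjoint H x ->
  bounded_by r x <-> forall u, `|ip (x u) u| <= r * rnorm u ^+ 2.
Proof.
move=> r0 xs; split=> [xr u|xr u].
  apply: (le_trans (cauchy_schwarz _ _)).
  by rewrite expr2 mulrA ler_wpM2r ?rnorm_ge0//; exact: xr.
have [->|] := eqVneq (rnorm (x u)) 0; first by rewrite mulr_ge0// rnorm_ge0.
rewrite neq_lt ltNge rnorm_ge0/= => xu0.
pose v := (rnorm u / rnorm (x u))%:C *: x u.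
have vu : rnorm v = rnorm u.
  rewrite /v rnormZ ger0_norm ?divr_ge0 ?rnorm_ge0// divfK//.
  exact: lt0r_neq0.
have /saP xs' := xs.
have := polarization_bound (@bop_linear x) xs' xr u v.
rewrite vu /v ipZr ip_sq (expr2 (rnorm (x u)))
  (mulrA (_ / _)) divfK ?lt0r_neq0//.
have [u0|] := eqVneq (rnorm u) 0.
  by move: xu0; rewrite (rnorm_eq0 u0) bop0 rnorm0 ltxx.
rewrite neq_lt ltNge rnorm_ge0/= => u0 h.
rewrite -(ler_pM2l u0); move: h; lra.
Qed.

Lemma re_part_bounded x y r : 0 <= r -> is_adjoint x y -> bounded_by r x ->
  bounded_by r (re_part x y).
Proof.
move=> r0 xy xr; apply/(sa_bounded_byP r0 (re_part_sa xy)) => u.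
have /adjointP yx := adjoint_sym xy.
have -> : ip (re_part x y u) u = ip (x u) u.
  by rewrite bopZE ipZl bopDE ipDl yx (ipC u); field.
apply: (le_trans (cauchy_schwarz _ _)).
by rewrite expr2 mulrA ler_wpM2r ?rnorm_ge0//; exact: xr.
Qed.

Lemma im_part_bounded x y r : 0 <= r -> is_adjoint x y -> bounded_by r x ->
  bounded_by r (im_part x y).
Proof.
move=> r0 xy xr; apply/(sa_bounded_byP r0 (im_part_sa xy)) => u.
have /adjointP yx := adjoint_sym xy.
have -> : ip (im_part x y u) u = ip (x u) ('i *: u).
  rewrite bopZE ipZl bopZE ipi bopDE bopNE ipDl ipNl yx bopZ (ipC u) ipi.
  by field.
apply: (le_trans (cauchy_schwarz _ _)).
by rewrite rnormi expr2 mulrA ler_wpM2r ?rnorm_ge0//; exact: xr.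
Qed.

(** This description of the norm by the order and the unit is what makes
    unital positive maps contractive on selfadjoint operators. *)
Lemma sa_bounded_by_order x r : 0 <= r -> selfadjoint H x ->
  bounded_by r x <-> op_ge0 (r%:C *: opid H - x) /\ op_ge0 (r%:C *: opid H + x).
Proof.
move=> r0 xs; have rs : selfadjoint H (r%:C *: opid H) by apply/saZ/sa_opid.
have h1 := op_ge0P (saD rs (saN xs)); have h2 := op_ge0P (saD rs xs).
have e1 u : ip ((r%:C *: opid H - x) u) u = r * rnorm u ^+ 2 - ip (x u) u.
  by rewrite bopDE bopNE bopZE ipDl ipNl ipZl ip_sq.
have e2 u : ip ((r%:C *: opid H + x) u) u = r * rnorm u ^+ 2 + ip (x u) u.
  by rewrite bopDE bopZE ipDl ipZl ip_sq.
rewrite sa_bounded_byP//; split=> [xr|[/h1 x1 /h2 x2] u].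
  split; [apply/h1|apply/h2] => u; have := xr u; rewrite ler_norml ?e1 ?e2;
  lra.
have := x1 u; have := x2 u; rewrite e1 e2 ler_norml; lra.
Qed.

End Operators.

(** * Riesz representation *)
Section Riesz.
Context {R : realType} {H : hilbertType R}.
Implicit Types (u v w : H) (r : R).
Variables (l : H -> R) (c : R).
Hypothesis lD : forall u v, l (u + v) = l u + l v.
Hypothesis lZ : forall r v, l (r%:C *: v) = r * l v.
Hypothesis lc : forall v, `|l v| <= c * rnorm v.

(* If [l] is represented by [w] then [J v = rnorm (v - w) ^+ 2 - rnorm w ^+
   2], so the representing vector has to be the minimizer of [J]. *)
Let J v := rnorm v ^+ 2 - 2 * l v.

Let J_ge v : - c ^+ 2 <= J v.
Proof.
have /ler_normlP[_ h] := lc v; rewrite /J; have := sqr_ge0 (rnorm v - c); nra.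
Qed.

Let m := inf (range J).

Let m_le v : m <= J v.
Proof.
by apply: ge_inf; [exists (- c ^+ 2) => _ [w _ <-]; exact: J_ge|exists v].
Qed.

Let m_adh e : 0 < e -> exists v, J v < m + e.
Proof.
move=> e0; have [|_ [v _ <-] h] := @inf_adherent _ (range J) e e0.
  split; first by exists (J 0), 0.
  by exists (- c ^+ 2) => _ [w _ <-]; exact: J_ge.
by exists v.
Qed.

(* The parallelogram law, by which minimizing filters are Cauchy. *)
Let near_minimizers u v e : J u < m + e -> J v < m + e ->
  rnorm (u - v) ^+ 2 <= 4 * e.
Proof.
move=> ue ve; have := m_le (2^-1%:C *: (u + v)).
rewrite /J lZ lD rnormZ ger0_norm ?invr_ge0// exprMn sq_rnormD.
move: ue ve; rewrite /J sq_rnormD ipNr rnormN => h1 h2 h3.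
have e4 : (2^-1 : R) ^+ 2 = 4^-1 by field.
move: h3; rewrite e4; lra.
Qed.

(* Compare [J u] with the minimum of [J] on the line through [u] along [v],
   which is [J u - (ip u v - l v) ^+ 2 / rnorm v ^+ 2]. *)
Let variation u v e : 0 <= e -> J u < m + e ^+ 2 ->
  `|ip u v - l v| <= e * rnorm v.
Proof.
move=> e0 ue; have [v0|v0] := eqVneq (rnorm v) 0.
  have /ler_normlP[h1 h2] := lc v; rewrite v0 (rnorm_eq0 v0) ip0r.
  move: h1 h2; rewrite v0 (rnorm_eq0 v0) !mulr0 sub0r normrN ler_norml => *;
    lra.
have {}v0 : 0 < rnorm v by rewrite lt_neqAle eq_sym v0 rnorm_ge0.
set d := ip u v - l v; pose t := - d / rnorm v ^+ 2.
have tt : t ^+ 2 * rnorm v ^+ 2 = d ^+ 2 / rnorm v ^+ 2.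
  by rewrite /t; field; exact: lt0r_neq0.
have td : t * ip u v - t * l v = - (d ^+ 2 / rnorm v ^+ 2).
  by rewrite -mulrBr /t -/d; field; exact: lt0r_neq0.
have := m_le (u + t%:C *: v).
rewrite /J lD lZ sq_rnormD ipZr rnormZ exprMn real_normK ?num_real// tt => h.
have h' : d ^+ 2 <= (e * rnorm v) ^+ 2.
  have : d ^+ 2 / rnorm v ^+ 2 <= e ^+ 2.
    by move: ue; rewrite /J; lra.
  by rewrite ler_pdivrMr ?exprn_gt0// exprMn.
by rewrite -(@ler_pXn2r _ 2) ?nnegrE ?mulr_ge0 ?rnorm_ge0
  ?real_normK ?num_real// ltW.
Qed.

Lemma riesz : exists w, forall v, ip w v = l v.
Proof.
pose F := filter_from [set e : R | 0 < e] (fun e => [set v | J v < m + e]).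
have FF : ProperFilter F.
  apply: filter_from_proper => [|e e0]; last exact: m_adh.
  apply: filter_from_filter; first by exists 1; exact: ltr01.
  move=> e f e0 f0; exists (Num.min e f); first by rewrite /= lt_min;
    apply/andP.
  move=> v /= h; split; apply: (lt_le_trans h);
    rewrite lerD2l ge_min lexx ?orbT//.
have Fc : cauchy F.
  apply: cauchy_exP => e e0.
  pose d := complex.Re e.
  have ed : e = d%:C by rewrite /d RRe_real// gtr0_real.
  have d0 : 0 < d by rewrite -ltcR -ed.
  have [v vd] := @m_adh (d ^+ 2 / 8) (divr_gt0 (exprn_gt0 2 d0) (ltr0n _ 8)).
  exists v, (d ^+ 2 / 8); first by rewrite /= divr_gt0// exprn_gt0.
  move=> u /= ud; rewrite -ball_normE /= ed rnormE ltcR.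
  have h := near_minimizers vd ud.
  rewrite -(@ltr_pXn2r _ 2) ?nnegrE ?rnorm_ge0 ?(ltW d0)//.
  apply: (le_lt_trans h); have := exprn_gt0 2 d0; lra.
have /cvg_ex[w Fw] : cvg F by exact: cauchy_cvg.
exists w => v.
have key e : 0 < e -> `|ip w v - l v| <= e * (2 * rnorm v).
  move=> e0.
  have : F (ball w e%:C) by apply: Fw; apply: nbhsx_ballx; rewrite ltcR.
  have : F [set u | J u < m + e ^+ 2] by exists (e ^+ 2) => //=;
    exact: exprn_gt0.
  move=> h1 h2; have [u [/= ue]] := filter_ex (filterI h1 h2).
  rewrite -ball_normE /= rnormE ltcR => wu.
  have h3 := variation v (ltW e0) ue.
  have h4 := cauchy_schwarz (w - u) v.
  have -> : ip w v - l v = ip (w - u) v + (ip u v - l v).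
    by rewrite ipDl ipNl; lra.
  rewrite (le_trans (ler_normD _ _))//.
  have := rnorm_ge0 v; nra.
apply/subr0_eq/eqP; rewrite -normr_eq0 eq_le normr_ge0 andbT.
apply/ler_addgt0Pl => e e0; rewrite addr0.
have v1 : 0 < 2 * rnorm v + 1 by have := rnorm_ge0 v; lra.
apply: (le_trans (key _ (divr_gt0 e0 v1))).
rewrite mulrAC ler_pdivrMr// ler_pM2l//; lra.
Qed.

End Riesz.

(** * The ultraweak topology through real functionals *)
Section ComplexLimits.
Context {R : realType}.

Lemma normcRe (z : R[i]) : `|complex.Re z|%:C <= `|z|.
Proof.
rewrite normc_def lecR -sqrtr_sqr ler_wsqrtr// lerDl sqr_ge0//.
Qed.

Lemma normcIm (z : R[i]) : `|complex.Im z|%:C <= `|z|.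
Proof.
rewrite normc_def lecR -sqrtr_sqr ler_wsqrtr// lerDr sqr_ge0//.
Qed.

Lemma normcReIm (z : R[i]) : `|z| <= (`|complex.Re z| + `|complex.Im z|)%:C.
Proof.
rewrite [z in leLHS]complexE (le_trans (ler_normD _ _))// normrM.
rewrite !normc_def /= !expr0n !addr0 expr1n add0r sqrtr1 mul1r !sqrtr_sqr.
by rewrite -rmorphD.
Qed.

Context {T : Type} (F : set_system T) {FF : Filter F}.

Lemma cvg_complexP (f : T -> R[i]^o) (z : R[i]^o) :
  f @ F --> z <->
  (fun x => complex.Re (f x)) @ F --> complex.Re z /\
  (fun x => complex.Im (f x)) @ F --> complex.Im z.
Proof.
split=> [/cvgrPdist_lt fz|[/cvgrPdist_lt fr /cvgrPdist_lt fi]].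
  split; apply/cvgrPdist_lt => e e0;
    have e0' : 0 < e%:C by rewrite ltcR.
    near=> x; rewrite -ltcR; apply: le_lt_trans (_ : `|z - f x| < _).
      by apply: le_trans (normcRe _); case: (z) (f x) => ? ? [].
    by near: x; exact: fz.
  near=> x; rewrite -ltcR; apply: le_lt_trans (_ : `|z - f x| < _).
    by apply: le_trans (normcIm _); case: (z) (f x) => ? ? [].
  by near: x; exact: fz.
apply/cvgrPdist_lt => e e0.
have ee : e = (complex.Re e)%:C by rewrite RRe_real// gtr0_real.
have e2 : 0 < complex.Re e / 2 by rewrite divr_gt0// -ltcR -ee.
near=> x; apply: (le_lt_trans (normcReIm _)); rewrite ee ltcR.
have : `|complex.Re z - complex.Re (f x)| < complex.Re e / 2 by near: x;
  exact: fr.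
have : `|complex.Im z - complex.Im (f x)| < complex.Re e / 2 by near: x;
  exact: fi.
case: (z) (f x) => ? ? [? ?] /=; lra.
Unshelve. all: by end_near. Qed.

End ComplexLimits.

Section Normal.
Context {R : realType} {H : hilbertType R}.
Implicit Types (x y z : 'B(H)) (u v w : nat -> H) (r : R).

Definition uw_re u v x : R := limn (series (fun n => ip (x (u n)) (v n))).

Definition sqsum u : R := limn (series (fun n => rnorm (u n) ^+ 2)).

Lemma uw_re_term_le u v x r n : 0 <= r -> bounded_by r x ->
  `|ip (x (u n)) (v n)| <= r / 2 * (rnorm (u n) ^+ 2 + rnorm (v n) ^+ 2).
Proof.
move=> r0 xr; apply: (le_trans (cauchy_schwarz _ _)).
have h1 := xr (u n); have h2 := rnorm_ge0 (v n); have h3 := rnorm_ge0 (u n).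
have := sqr_ge0 (rnorm (u n) - rnorm (v n)); nra.
Qed.

Lemma cvg_uw_re_abs u v x : square_summable u -> square_summable v ->
  cvgn [normed series (fun n => ip (x (u n)) (v n))].
Proof.
move=> us vs; have [r r0 xr] := bop_bounded x.
apply: (series_le_cvg _ _ (fun n => uw_re_term_le u v n r0 xr)) => // [n|].
  by rewrite mulr_ge0 ?divr_ge0// addr_ge0// sqr_ge0.
by have := @is_cvg_seriesZ _ _ (r / 2) (is_cvg_seriesD us vs).
Qed.

Lemma cvg_uw_re u v x : square_summable u -> square_summable v ->
  series (fun n => ip (x (u n)) (v n)) @ \oo --> uw_re u v x.
Proof. by move=> us vs; apply: normed_cvg; exact: cvg_uw_re_abs. Qed.

Lemma square_summablei u : square_summable u ->
  square_summable (fun n => 'i *: u n).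
Proof.
rewrite /square_summable /=; set f := fun n => rnorm (u n) ^+ 2.
by have -> : (fun n => rnorm ('i *: u n) ^+ 2) = f
  by apply/funext => n; rewrite rnormi.
Qed.

Lemma uw_functionalE u v x : square_summable u -> square_summable v ->
  uw_functional u v x = uw_re u v x +i* uw_re u (fun n => 'i *: v n) x.
Proof.
move=> us vs; apply: cvg_lim; first exact: norm_hausdorff.
apply/cvg_complexP; split => /=.
  rewrite (_ : (fun n => _) = series (fun n => ip (x (u n)) (v n))).
    exact: cvg_uw_re.
  apply/funext => n; rewrite /series/=.
  rewrite (big_morph (@complex.Re R) (id1 := 0) (op1 := +%R)) //.
  by move=> [? ?] [].
rewrite (_ : (fun n => _) = series (fun n => ip (x (u n)) ('i *: v n))).
  by apply: cvg_uw_re => //; exact: square_summablei.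
apply/funext => n; rewrite /series/=.
rewrite (big_morph (@complex.Im R) (id1 := 0) (op1 := +%R)) //.
  by under eq_bigr do rewrite hdot_ip.
by move=> [? ?] [].
Qed.

(** The imaginary part of an ultraweak functional is the real part of another
    one, so real parts already generate the topology. *)
Lemma cvg_bopP (T : Type) (F : set_system T) (FF : Filter F)
    (f : T -> 'B(H)) x :
  f @ F --> x <-> forall u v, square_summable u -> square_summable v ->
    uw_re u v (f y) @[y --> F] --> uw_re u v x.
Proof.
split=> [fx u v us vs|fx].
  have /cvg_sup /(_ (SigSub (mem_set us), SigSub (mem_set vs))) := fx.
  move=> fxw.
  have : uw_functional u v (f y) @[y --> F] --> uw_functional u v x.
    move=> A /(@initial_continuous _ _ (uw_functional u v) x).
    exact: fxw.
  move/cvg_complexP => [+ _]; rewrite uw_functionalE//.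
  by under eq_fun do rewrite uw_functionalE//.
apply/cvg_sup => -[[u us] [v vs]] A /= [_ [[B Bop <-] Bx BA]].
have {}us : square_summable u by exact: set_mem.
have {}vs : square_summable v by exact: set_mem.
have : uw_functional u v (f y) @[y --> F] --> uw_functional u v x.
  rewrite (uw_functionalE x)//; apply/cvg_complexP; split=> /=.
    by under eq_fun do rewrite uw_functionalE//; exact: fx.
  under eq_fun do rewrite uw_functionalE//.
  by apply: fx => //; exact: square_summablei.
move=> /(_ B (open_nbhs_nbhs (conj Bop Bx))) FB.
by apply: (@filterS _ F _ _ _ _ FB) => y /BA.
Qed.

Lemma uw_reD u v x y : square_summable u -> square_summable v ->
  uw_re u v (x + y) = uw_re u v x + uw_re u v y.
Proof.
move=> us vs; apply: cvg_lim => //; rewrite (_ : series _ =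
  series (fun n => ip (x (u n)) (v n)) + series (fun n => ip (y (u n)) (v n))).
  by apply: cvgD; exact: cvg_uw_re.
apply/funext => n; rewrite /series/= /GRing.add/= -big_split /=.
by apply: eq_bigr => k _; rewrite -ipDl.
Qed.

Lemma uw_reZ u v r x : square_summable u -> square_summable v ->
  uw_re u v (r%:C *: x) = r * uw_re u v x.
Proof.
move=> us vs; apply: cvg_lim => //; rewrite (_ : series _ =
  (fun k => r * series (fun n => ip (x (u n)) (v n)) k)).
  by apply: cvgMr; exact: cvg_uw_re.
apply/funext => n; rewrite /series/= big_distrr/=.
by apply: eq_bigr => k _; rewrite -ipZl.
Qed.

Lemma uw_re_i u v x : uw_re u v ('i *: x) = uw_re (fun n => 'i *: u n) v x.
Proof.
by congr (limn (series _)); apply/funext => n; rewrite bopZ.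
Qed.

Lemma uw_re_adjoint u v x y : is_adjoint x y -> uw_re u v x = uw_re v u y.
Proof.
move=> /adjointP xy.
by congr (limn (series _)); apply/funext => n; rewrite xy ipC.
Qed.

Lemma uw_re_le u v x r : square_summable u -> square_summable v ->
  0 <= r -> bounded_by r x -> `|uw_re u v x| <= r / 2 * (sqsum u + sqsum v).
Proof.
move=> us vs r0 xr.
have := lim_series_norm (cvg_uw_re_abs (x := x) us vs).
move/le_trans; apply.
have uv := is_cvg_seriesD us vs.
have := @lim_seriesZ _ _ (r / 2) uv; rewrite lim_seriesD// => e.
rewrite [leRHS](esym e); apply: lim_series_le => [||n].
- exact: cvg_uw_re_abs.
- exact: is_cvg_seriesZ.
- exact: uw_re_term_le.
Qed.

End Normal.

(** * Ultraweak compactness of balls *)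
Section UltrafilterLimit.
Context {R : realType} {T : Type} (F : set_system T) {FU : UltraFilter F}.

Lemma ultra_bounded_cvg (f : T -> R) (c : R) :
  (\forall y \near F, `|f y| <= c) -> exists l : R, f @ F --> l.
Proof.
move=> fc.
have fF : (f @ F) `[- c, c]%classic.
  by apply: filterS fc => y /=; rewrite in_itv /= ler_norml.
have PF : ProperFilter (f @ F) by exact: fmap_proper_filter.
have [l [_ lF]] := @segment_compact R (- c) c (f @ F) PF fF.
exists l; apply/cvgrPdist_lt => e e0.
have [//|nF] := in_ultra_setVsetC [set y | `|l - f y| < e] FU.
pose B := [set t : R | `|l - t| < e].
have lb : nbhs l B by exact: (nbhsx_ballx l e e0).
have lb' : (f @ F) (~` B) by exact: nF.
by have [t []] := lF _ _ lb' lb.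
Qed.

End UltrafilterLimit.

Section Compactness.
Context {R : realType} {H : hilbertType R}.
Implicit Types (x y z : 'B(H)) (r : R).

Lemma series_split (f : nat -> R) N n :
  series f (n + N)%N = series f N + series (fun k => f (k + N)%N) n.
Proof.
rewrite series_addn; congr (_ + _); rewrite /series/=.
have -> : \sum_(N <= k < n + N) f k = \sum_(0 + N <= k < n + N) f k.
  by rewrite add0n.
by rewrite big_addn addnK.
Qed.

Lemma square_summable_shift (u : nat -> H) N : square_summable u ->
  square_summable (fun n => u (n + N)%N) /\
  sqsum (fun n => u (n + N)%N) = sqsum u - series (fun n => rnorm (u n) ^+ 2) N.
Proof.
move=> us; set f := fun n => rnorm (u n) ^+ 2.
have : series (fun n => rnorm (u (n + N)%N) ^+ 2) @ \oo -->
    sqsum u - series f N.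
  rewrite (_ : series _ = (fun n => series f (n + N)%N - series f N)).
    by apply: cvgB; [rewrite cvg_shiftn; exact: us|exact: cvg_cst].
  by apply/funext => n; rewrite series_split addrAC subrr add0r.
by move=> h; split; [apply/cvg_ex; eexists; exact: h|exact: cvg_lim h].
Qed.

Lemma uw_re_split u v x N : square_summable u -> square_summable v ->
  uw_re u v x = series (fun n => ip (x (u n)) (v n)) N +
    uw_re (fun n => u (n + N)%N) (fun n => v (n + N)%N) x.
Proof.
move=> us vs; have [us' _] := square_summable_shift N us.
have [vs' _] := square_summable_shift N vs.
apply: cvg_lim => //; set f := fun n => _; rewrite -(cvg_shiftn N).
rewrite (_ : [sequence _]_n = (fun n => series f N +
   series (fun n => ip (x (u (n + N)%N)) (v (n + N)%N)) n)).
  by apply: cvgD; [exact: cvg_cst|exact: cvg_uw_re].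
by apply/funext => n; rewrite /= series_split.
Qed.

Lemma sqsum_tail (u : nat -> H) e : square_summable u -> 0 < e ->
  \forall N \near \oo, sqsum (fun n => u (n + N)%N) < e.
Proof.
move=> us e0; near=> N; have [_ ->] := square_summable_shift N us.
have : `|sqsum u - series (fun n => rnorm (u n) ^+ 2) N| < e.
  by near: N; move: us => /cvgrPdist_lt; apply.
by apply: le_lt_trans; exact: ler_norm.
Unshelve. all: by end_near. Qed.

Definition coef (u v : H) y : R := ip (y u) v.

(** On norm-bounded sets, ultraweak convergence is convergence of the matrix
    coefficients: the tails of the series defining [uw_re u v] are uniformly
    small there. *)
Lemma weak_cvg (F : set_system 'B(H)) (FF : ProperFilter F) x r : 0 <= r ->
  F [set y : 'B(H) | bounded_by r y] -> bounded_by r x ->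
  (forall u v, coef u v @ F --> coef u v x) -> F --> x.
Proof.
move=> r0 Fr xr Fx; apply/(@cvg_bopP _ _ _ _ _ id) => u v us vs.
apply/cvgrPdist_lt => e e0.
have d0 : 0 < e / (4 * (r + 1)) by apply: divr_gt0 => //; lra.
near \oo => N.
have hu : sqsum (fun n => u (n + N)%N) < e / (4 * (r + 1)).
  by near: N; exact: sqsum_tail.
have hv : sqsum (fun n => v (n + N)%N) < e / (4 * (r + 1)).
  by near: N; exact: sqsum_tail.
have [us' _] := square_summable_shift N us.
have [vs' _] := square_summable_shift N vs.
have tail y : bounded_by r y ->
  `|uw_re (fun n => u (n + N)%N) (fun n => v (n + N)%N) y| <= e / 4.
  move=> yr; apply: (le_trans (uw_re_le us' vs' r0 yr)).
  have E : e / 4 = e / (4 * (r + 1)) * (r + 1) by field; lra.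
  rewrite E; nra.
have fin : series (fun n => ip (y (u n)) (v n)) N @[y --> F] -->
    series (fun n => ip (x (u n)) (v n)) N.
  by apply: cvg_big => [|i _]; [exact: add_continuous|exact: Fx].
near=> y; rewrite (uw_re_split x N)// (uw_re_split y N)//.
have yr : bounded_by r y by near: y.
have := tail x xr; have := tail y yr;
  rewrite !ler_norml => /andP[] ? ? /andP[] ? ?.
have : `|series (fun n => ip (x (u n)) (v n)) N -
         series (fun n => ip (y (u n)) (v n)) N| < e / 4.
  by near: y; move/cvgrPdist_lt: fin; apply; rewrite divr_gt0.
rewrite !ltr_norml => /andP[] ? ?; lra.
Unshelve. all: by end_near. Qed.

Definition sa_ball (M : set 'B(H)) r : set 'B(H) :=
  M `&` selfadjoint H `&` [set x : 'B(H) | bounded_by r x].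

(** Along an ultrafilter all matrix coefficients converge; by [riesz] the
    limit form is the form of an operator, which is the ultraweak limit. *)
Lemma compact_sa_ball M r : closed M -> 0 <= r -> compact (sa_ball M r).
Proof.
move=> Mc r0; rewrite compact_ultra => F FU FB.
have Fb : F [set y : 'B(H) | bounded_by r y] by apply: filterS FB => y [].
have lim u v : exists l : R, coef u v @ F --> l.
  apply: (@ultra_bounded_cvg _ _ F FU _ (r * rnorm u * rnorm v)).
  near=> y; have yr : bounded_by r y by near: y.
  apply: (le_trans (cauchy_schwarz _ _)).
  by rewrite ler_wpM2r ?rnorm_ge0.
have /choice[b bP] : forall uv, exists l : R, coef uv.1 uv.2 @ F --> l.
  by move=> uv; exact: lim.
have bE u v : coef u v @ F --> b (u, v) by exact: bP.
have b_le u v : `|b (u, v)| <= r * rnorm u * rnorm v.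
  apply: (cvgr_to_le (cvg_norm (bE u v))).
  near=> y; have yr : bounded_by r y by near: y.
  apply: (le_trans (cauchy_schwarz _ _)).
  by rewrite ler_wpM2r ?rnorm_ge0.
have uniq (f : 'B(H) -> R) (s t : R) : f @ F --> s -> f @ F --> t -> s = t.
  by move=> fs ft; rewrite -(cvg_lim (@Rhausdorff R) fs); exact: cvg_lim ft.
have /choice[q qP] : forall u, exists w, forall v, ip w v = b (u, v).
  move=> u; apply: (@riesz _ _ (fun v => b (u, v)) (r * rnorm u)) =>
    // [v w|s v].
    apply: (uniq _ _ _ (bE u (v + w))).
    rewrite (_ : coef _ _ = coef u v \+ coef u w); first by apply: cvgD;
      exact: bE.
    by apply/funext => y; rewrite /coef ipDr.
  apply: (uniq _ _ _ (bE u _)).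
  rewrite (_ : coef _ _ = fun y => s * coef u v y); first by apply: cvgMr;
    exact: bE.
  by apply/funext => y; rewrite /coef ipZr.
have qlim u v : coef u v @ F --> ip (q u) v by rewrite qP.
have ql : linear q.
  move=> a u v; apply: ip_inj => w; apply: (uniq _ _ _ (qlim _ w)).
  rewrite (_ : coef _ _ = coef u (a^* *: w) \+ coef v w).
    by rewrite ipDl ipJ; apply: cvgD; exact: qlim.
  by apply/funext => y; rewrite /coef bop_linear ipDl ipJ.
have qb : bounded_by r q.
  move=> u; have := b_le u (q u); rewrite -qP ip_sq.
  rewrite ger0_norm ?sqr_ge0// expr2.
  have [->|] := eqVneq (rnorm (q u)) 0; first by rewrite mulr_ge0 ?rnorm_ge0.
  by rewrite neq_lt ltNge rnorm_ge0/= => q0; rewrite ler_pM2r.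
pose x := Bop (bounded_by_bop ql qb).
have PF : @ProperFilter 'B(H) F by exact: ultra_proper.
have Fx := @weak_cvg F PF x r r0 Fb qb qlim.
exists x; split => //; split => //; split.
  apply: (closed_cvg (F := F) (u_ := id) M Mc _ x Fx).
  by apply: filterS FB => y [[]].
apply/saP => u v; apply: (uniq _ _ _ (qlim u v)).
rewrite [ip u _]ipC; apply: cvg_trans (qlim v u).
apply: near_eq_cvg; near=> y.
have /saP ys : selfadjoint H y by near: y; apply: filterS FB => y [[]].
by rewrite /coef ys ipC.
Unshelve. all: by end_near. Qed.

End Compactness.

(** * A minimax theorem *)
Lemma within_cvg_comp (T U : topologicalType) (B : set T) (f : T -> U) x
    (G : set_system T) {FG : Filter G} :
  {within B, continuous f} -> B x -> G B -> G --> x -> f @ G --> f x.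
Proof.
move=> /subspace_continuousP fB Bx GB Gx; apply: cvg_trans (fB x Bx).
move=> A /= /Gx; apply: filterS2 GB => y By; exact.
Qed.

Section Minimax.
Context {R : realType} {T : topologicalType}.
Implicit Types (B : set T) (f g h : T -> R) (Fam : set (T -> R)).

(** Convexity of [B] as it is seen by the functions of [Fam]; linear
    structures enter only when this is applied. *)
Definition affine_on B Fam := forall x y t, B x -> B y -> 0 <= t <= 1 ->
  exists2 z, B z & forall f, Fam f -> f z = t * f x + (1 - t) * f y.

Definition convex_family B Fam := forall f g t, Fam f -> Fam g -> 0 <= t <= 1 ->
  exists2 h, Fam h & forall x, B x -> h x = t * f x + (1 - t) * g x.

Definition negsq (a : R) := Num.max 0 (- a) ^+ 2.

Let negsq_le a d t : negsq (a + t * d) <= (Num.max 0 (- a) - t * d) ^+ 2.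
Proof. rewrite /negsq !maxEle; case: ifPn; case: ifPn; rewrite -?ltNge;
  nra. Qed.

Lemma continuous_negsq : continuous negsq.
Proof.
move=> a.
apply: (@continuous_comp _ _ _ (fun b : R => Num.max 0 (- b))
  (fun b => b ^+ 2)).
  by apply: continuous_max; [exact: cvg_cst|exact: opp_continuous].
exact: exprn_continuous.
Qed.

(** Let [x] minimize the sum of the squares of the negative parts of [f] and
    [g]. If these negative parts [p] and [q] are not both zero, the first
    variation at [x] gives [p * f y + q * g y <= - p ^+ 2 - q ^+ 2 < 0] for
    all [y], against the hypothesis on the convex combination with weights
    proportional to [p] and [q]. *)
Lemma minimax2 B Fam f g : compact B ->
  (forall h, Fam h -> {within B, continuous h}) ->
  affine_on B Fam -> convex_family B Fam ->
  (forall h, Fam h -> exists2 x, B x & 0 <= h x) ->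
  Fam f -> Fam g -> exists x, [/\ B x, 0 <= f x & 0 <= g x].
Proof.
move=> Bc Famc Baff Fconv Fpos Ff Fg.
have [x0 Bx0 _] := Fpos _ Ff.
pose D x := negsq (f x) + negsq (g x).
have Dc : {within B, continuous D}.
  move=> x; apply: cvgD.
    by apply: continuous_comp; [exact: (Famc f)|exact: continuous_negsq].
  by apply: continuous_comp; [exact: (Famc g)|exact: continuous_negsq].
have [x /set_mem Bx Dx] := compact_EVT_min (ex_intro _ x0 Bx0) Bc Dc.
pose p := Num.max 0 (- f x); pose q := Num.max 0 (- g x).
have p0 : 0 <= p by rewrite le_max lexx.
have q0 : 0 <= q by rewrite le_max lexx.
have pf : p * f x = - p ^+ 2.
  by rewrite /p maxEle; case: ifPn => _; rewrite ?mul0r ?expr0n ?oppr0//; ring.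
have qg : q * g x = - q ^+ 2.
  by rewrite /q maxEle; case: ifPn => _; rewrite ?mul0r ?expr0n ?oppr0//; ring.
have [pq|pq] := eqVneq (p + q) 0.
  exists x; split=> //.
    have : - f x <= p by rewrite le_max lexx orbT.
    lra.
  have : - g x <= q by rewrite le_max lexx orbT.
  lra.
have {}pq : 0 < p + q by rewrite lt_neqAle eq_sym pq addr_ge0.
have var y : B y -> p * (f y - f x) + q * (g y - g x) <= 0.
  move=> By; set c := p * _ + _; set d := (f y - f x) ^+ 2 + (g y - g x) ^+ 2.
  have d0 : 0 <= d by rewrite addr_ge0 ?sqr_ge0.
  have h t : 0 < t <= 1 -> 2 * c <= t * d.
    move=> /andP[t0 t1]; have [|z Bz zE] := Baff y x t By Bx;
      first by rewrite ltW.
    have := Dx z (mem_set Bz); rewrite /D !zE//.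
    have E (k : T -> R) :
        t * k y + (1 - t) * k x = k x + t * (k y - k x) by ring.
    rewrite !E => h1.
    have h2 := negsq_le (f x) (f y - f x) t.
    have h3 := negsq_le (g x) (g y - g x) t.
    have h4 : negsq (f x) = p ^+ 2 by [].
    have h5 : negsq (g x) = q ^+ 2 by [].
    rewrite -/p in h2; rewrite -/q in h3.
    rewrite -(ler_pM2l t0) /c /d; move: h1 h2 h3; rewrite h4 h5; nra.
  rewrite leNgt; apply/negP => c0.
  have := h 1; rewrite ltr01 lexx mul1r => /(_ isT) cd.
  have d1 : 0 < d by lra.
  have := h (c / d); rewrite divr_gt0// ler_pdivrMr// mul1r divfK ?lt0r_neq0//.
  move=> H; have : 2 * c <= c by apply: H; lra.
  lra.
have [|h Fh hE] := Fconv f g (p / (p + q)) Ff Fg.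
  by rewrite divr_ge0 ?(ltW pq)// ler_pdivrMr//; lra.
have [y By] := Fpos h Fh; rewrite hE// => hy.
have E : 1 - p / (p + q) = q / (p + q) by field; exact: lt0r_neq0.
have : 0 <= p * f y + q * g y.
  have -> : p * f y + q * g y =
      (p + q) * (p / (p + q) * f y + q / (p + q) * g y).
    by field; exact: lt0r_neq0.
  by rewrite mulr_ge0 ?(ltW pq)// -E.
have : 0 < (p + q) ^+ 2 by exact: exprn_gt0.
have := sqr_ge0 (p - q); have := var y By; move: pf qg; lra.
Qed.

Lemma compact_nonneg B f : compact B -> {within B, continuous f} ->
  compact (B `&` [set x | 0 <= f x]).
Proof.
rewrite !compact_ultra => Bc fc G GU GB.
have GB' : G B by apply: filterS GB => y [].
have [x [Bx Gx]] := Bc G GU GB'.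
exists x; split=> //; split=> //=.
have GP : ProperFilter G by exact: ultra_proper.
apply: (cvgr_to_ge (within_cvg_comp fc Bx GB' Gx)).
by apply: filterS GB => y [].
Qed.

(** By compactness finitely many functions suffice. They are treated one at a
    time: restricting [B] to the set where the first one is nonnegative
    preserves all the hypotheses, by [minimax2]. *)
Lemma minimax B Fam : compact B -> B !=set0 ->
  (forall h, Fam h -> {within B, continuous h}) ->
  affine_on B Fam -> convex_family B Fam ->
  (forall h, Fam h -> exists2 x, B x & 0 <= h x) ->
  exists2 x, B x & forall f, Fam f -> 0 <= f x.
Proof.
move=> Bc B0 Famc Baff Fconv Fpos.
have fin (s : seq (T -> R)) : {in s, forall f, Fam f} ->
    exists2 x, B x & {in s, forall f, 0 <= f x}.
  elim: s B Bc B0 Famc Baff Fconv Fpos =>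
    [|f s IH] B Bc B0 Famc Baff Fconv Fpos sF.
    by have [x Bx] := B0; exists x.
  have Ff : Fam f by apply: sF; rewrite mem_head.
  have [|||||h Fh|g gs|x [Bx fx] xs] := IH (B `&` [set x | 0 <= f x]).
  - exact: compact_nonneg (Famc _ Ff).
  - by have [x] := Fpos _ Ff; exists x.
  - by move=> h Fh; apply: continuous_subspaceW (Famc h Fh) => x [].
  - move=> x y t [Bx /= fx] [By /= fy] t01;
      have [z Bz zE] := Baff x y t Bx By t01.
    exists z => //; split=> //=; rewrite zE//.
    by move: t01 => /andP[t0 t1]; rewrite addr_ge0// mulr_ge0// subr_ge0.
  - move=> g h t Fg Fh t01; have [k Fk kE] := Fconv g h t Fg Fh t01.
    by exists k => // x [Bx _]; exact: kE.
  - have [x [Bx fx hx]] := minimax2 Bc Famc Baff Fconv Fpos Ff Fh.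
    by exists x.
  - by apply: sF; rewrite in_cons gs orbT.
  by exists x => // g; rewrite in_cons => /orP[/eqP ->//|]; exact: xs.
pose base (s : seq (T -> R)) := B `&` [set x | {in s, forall f, 0 <= f x}].
pose G := filter_from [set s : seq (T -> R) | {in s, forall f, Fam f}] base.
have GF : ProperFilter G.
  apply: filter_from_proper => [|s sF]; last by have [x Bx xs] := fin s sF;
    exists x.
  apply: filter_from_filter; first by exists [::].
  move=> s1 s2 s1F s2F; exists (s1 ++ s2).
    by move=> f; rewrite mem_cat => /orP[/s1F|/s2F].
  move=> x [Bx xs]; split; split=> // f fs; apply: xs;
    by rewrite mem_cat fs ?orbT.
have [U [UU GU]] := ultraFilterLemma GF.
have UB : U B by apply: GU; exists [::] => // x [].
move: (Bc); rewrite compact_ultra => /(_ U UU UB)[x [Bx Ux]].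
have UP : ProperFilter U by exact: ultra_proper.
exists x => // f Ff; apply: (cvgr_to_ge (within_cvg_comp (Famc f Ff) Bx UB Ux)).
apply: GU; exists [:: f] => [g|y [_ /= ys]]; first by rewrite inE => /eqP ->.
by apply: ys; rewrite mem_head.
Qed.

End Minimax.

(** * Finite sums of vector functionals *)
Section Lists.
Context {R : realType} {H : hilbertType R}.
Implicit Types (x y z : 'B(H)) (r s t : R) (L : seq (H * H)) (u v : nat -> H).

Lemma continuous_uw_re u v : square_summable u -> square_summable v ->
  continuous (uw_re u v).
Proof.
by move=> us vs x; apply: (cvg_bopP (nbhs_filter x) id x).1 => //;
  exact: cvg_id.
Qed.

(** A list of pairs [(u, v)] encodes the functional [x |-> \sum Re <x u, v>].
    Its weight bounds its norm by [vsum_le], and the lists of weight at most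
    one are enough to compute the norm of an operator by [vsum_norming]. Lists
    are used because convex combinations and sums are concatenations. *)
Definition vsum L x : R := \sum_(p <- L) coef p.1 p.2 x.
Definition vweight L : R := \sum_(p <- L) (rnorm p.1 ^+ 2 + rnorm p.2 ^+ 2) / 2.

Lemma vsum_cat L1 L2 x : vsum (L1 ++ L2) x = vsum L1 x + vsum L2 x.
Proof. exact: big_cat. Qed.

Lemma vweight_cat L1 L2 : vweight (L1 ++ L2) = vweight L1 + vweight L2.
Proof. exact: big_cat. Qed.

Definition vscale s L := [seq (s%:C *: p.1, s%:C *: p.2) | p <- L].

Lemma vsum_scale s L x : vsum (vscale s L) x = s ^+ 2 * vsum L x.
Proof.
rewrite /vsum big_map big_distrr/=; apply: eq_bigr => p _.
by rewrite /coef bopZ ipZl ipZr expr2 mulrA.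
Qed.

Lemma vweight_scale s L : vweight (vscale s L) = s ^+ 2 * vweight L.
Proof.
rewrite /vweight big_map big_distrr/=; apply: eq_bigr => p _.
by rewrite !rnormZ !exprMn !real_normK ?num_real//; ring.
Qed.

Lemma vweight_ge0 L : 0 <= vweight L.
Proof. by apply: sumr_ge0 => p _; rewrite divr_ge0// addr_ge0// sqr_ge0. Qed.

Lemma vsum_le L x r : 0 <= r -> bounded_by r x -> `|vsum L x| <= r * vweight L.
Proof.
move=> r0 xr; rewrite /vweight big_distrr/=;
  apply: le_trans (ler_norm_sum _ _ _) _.
apply: ler_sum => p _;
  apply: le_trans (uw_re_term_le (fun=> p.1) (fun=> p.2) 0 r0 xr) _.
by rewrite /= mulrA mulrAC.
Qed.

Lemma vsumD L x y : vsum L (x + y) = vsum L x + vsum L y.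
Proof. by rewrite /vsum -big_split/=; apply: eq_bigr => p _; rewrite -ipDl. Qed.

Lemma vsumZ L s x : vsum L (s%:C *: x) = s * vsum L x.
Proof. by rewrite /vsum big_distrr/=; apply: eq_bigr => p _; rewrite -ipZl. Qed.

Lemma vsum_combine L1 L2 t : 0 <= t <= 1 -> exists L,
  (forall x, vsum L x = t * vsum L1 x + (1 - t) * vsum L2 x) /\
  vweight L = t * vweight L1 + (1 - t) * vweight L2.
Proof.
move=> /andP[t0 t1];
exists (vscale (Num.sqrt t) L1 ++ vscale (Num.sqrt (1 - t)) L2).
split=> [x|]; rewrite ?vsum_cat ?vweight_cat ?vsum_scale ?vweight_scale
  !sqr_sqrtr// subr_ge0//.
Qed.

(** The bound at [u] comes from the pair [(u, x u)], with both entries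
    rescaled to have square norm [s]. *)
Lemma vsum_norming x s c : 0 < s ->
  (forall L, vweight L <= s -> vsum L x <= s * c) -> bounded_by c x.
Proof.
move=> s0 h u.
have c0 : 0 <= c.
  by have := h [::]; rewrite /vweight /vsum !big_nil => /(_ (ltW s0));
    rewrite pmulr_rge0.
have [->|] := eqVneq (rnorm (x u)) 0; first by rewrite mulr_ge0 ?rnorm_ge0.
rewrite neq_lt ltNge rnorm_ge0/= => xu0.
have [u0|] := eqVneq (rnorm u) 0.
  by move: xu0; rewrite (rnorm_eq0 u0) bop0 rnorm0 ltxx.
rewrite neq_lt ltNge rnorm_ge0/= => u0.
have := h [:: ((Num.sqrt s / rnorm u)%:C *: u,
               (Num.sqrt s / rnorm (x u))%:C *: x u)].
rewrite /vweight /vsum !big_seq1/= /coef bopZ ipZl ipZr ip_sq !rnormZ.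
rewrite !ger0_norm ?divr_ge0 ?sqrtr_ge0 ?(ltW u0) ?(ltW xu0)//.
rewrite !divfK ?lt0r_neq0// !sqr_sqrtr ?(ltW s0)//.
have -> : (s + s) / 2 = s by field.
move=> /(_ (lexx _)).
have -> : Num.sqrt s / rnorm u * (Num.sqrt s / rnorm (x u) * rnorm (x u) ^+ 2) =
   Num.sqrt s ^+ 2 * (rnorm (x u) / rnorm u).
  by field; rewrite !lt0r_neq0.
by rewrite sqr_sqrtr ?(ltW s0)// ler_pM2l// ler_pdivrMr.
Qed.

Lemma vsum_separates x y : (forall L, vsum L y <= vsum L x) -> x = y.
Proof.
move=> xy; apply: bop_ext => u; apply: ip_inj => v; apply/eqP; rewrite eq_le.
have := xy [:: (u, v)]; have := xy [:: (u, - v)].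
by rewrite /vsum !big_seq1/= /coef !ipNr lerN2 => -> ->.
Qed.

(** Finite sums of vector functionals with summable weights add up to an
    ultraweak functional: its sequences of vectors are the lists laid end to
    end. *)
Lemma concat_functional (Ls : nat -> seq (H * H)) :
    cvgn (series (fun k => vweight (Ls k))) ->
  exists u v, [/\ square_summable u, square_summable v &
    forall x, series (fun k => vsum (Ls k) x) @ \oo --> uw_re u v x].
Proof.
move=> wcvg; set d := (0, 0) : H * H.
(* The zero pair [d] in front of each block makes the [k]-th prefix have at
   least [k] entries, so that [U] below is defined by prefixes and partial
   sums over prefixes are cofinal. *)
pose S := fix S k := if k is j.+1 then S j ++ d :: Ls j else [::].
have S_size k : (k <= size (S k))%N.
  by elim: k => //= k IH;
    rewrite size_cat /= addnS ltnS (leq_trans IH)// leq_addr.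
have S_nth k m n : (k <= m)%N -> (n < size (S k))%N ->
    nth d (S m) n = nth d (S k) n.
  move=> /subnK <- nk; elim: (m - k)%N => //= j IH.
  rewrite nth_cat; case: ifPn => // /negP[]; rewrite addnC.
  elim: j {IH} => [|j IH]; first by rewrite addn0.
  by rewrite addnS /= size_cat (leq_trans IH)// leq_addr.
pose U n := nth d (S n.+1) n.
have sumS (h : H * H -> R) k :
    series (fun n => h (U n)) (size (S k)) = \sum_(p <- S k) h p.
  rewrite (big_nth d) /series/= !big_nat; apply: eq_bigr => i /= ik.
  congr (h _); rewrite /U; have [ki|ki] := leqP k i.+1;
    first by rewrite (S_nth k).
  by rewrite (S_nth i.+1 k)// ltnW.
have wS k : \sum_(p <- S k) (rnorm p.1 ^+ 2 + rnorm p.2 ^+ 2) / 2 =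
    series (fun k => vweight (Ls k)) k.
  elim: k => [|k IH]; first by rewrite /series/= big_nil big_geq.
  rewrite seriesSr -IH /= big_cat big_cons /=; congr (_ + _).
  by rewrite rnorm0 expr0n addr0 mul0r add0r.
have ss (q : H * H -> H) :
    (forall p,
     rnorm (q p) ^+ 2 <= 2 * ((rnorm p.1 ^+ 2 + rnorm p.2 ^+ 2) / 2)) ->
  square_summable (q \o U).
  move=> qle.
  have mono : nondecreasing_seq (series (fun n => rnorm ((q \o U) n) ^+ 2)).
    by apply: nondecreasing_series => n _ _; exact: sqr_ge0.
  apply: nondecreasing_is_cvgn => //.
  exists (2 * limn (series (fun k => vweight (Ls k)))) => _ [n _ <-].
  apply: (le_trans (mono _ _ (S_size n))).
  rewrite (sumS (fun p => rnorm (q p) ^+ 2)).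
  apply: (@le_trans _ _ (2 * series (fun k => vweight (Ls k)) n)).
    by rewrite -wS big_distrr/=; apply: ler_sum => p _; exact: qle.
  rewrite ler_pM2l//; apply: nondecreasing_cvgn_le => //.
  by apply: nondecreasing_series => k _ _; exact: vweight_ge0.
have us : square_summable (fst \o U).
  by apply: ss => p; have := sqr_ge0 (rnorm p.2); lra.
have vs : square_summable (snd \o U).
  by apply: ss => p; have := sqr_ge0 (rnorm p.1); lra.
exists (fst \o U), (snd \o U); split=> // x.
have size_cvg : (size \o S) @ \oo --> \oo.
  by move=> A [N _ NA]; exists N => // k /= Nk; apply: NA;
    exact: leq_trans (S_size k).
have := cvg_comp _ _ size_cvg (cvg_uw_re (x := x) us vs).
rewrite (_ : _ \o _ = series (fun k => vsum (Ls k) x)) //.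
apply/funext => k /=; rewrite (sumS (fun p => coef p.1 p.2 x)).
elim: k => [|k IH]; first by rewrite /series/= big_nil big_geq.
rewrite seriesSr -IH /= big_cat big_cons /=; congr (_ + _).
by rewrite /coef bop0 ip0l add0r.
Qed.

Lemma vsum_uw_re L : exists u v,
  [/\ square_summable u, square_summable v & vsum L = uw_re u v].
Proof.
pose Ls k := if k is 0%N then L else [::] : seq (H * H).
have lim (f : nat -> R) : (forall n, f n.+1 = 0) -> series f @ \oo --> f 0%N.
  move=> f0; apply: cvg_near_cst; exists 1%N => // -[//|n] _.
  by rewrite /series/= big_nat_recl// big1 ?addr0.
have [|u [v [us vs uv]]] := @concat_functional Ls.
  by apply/cvg_ex; eexists; apply: lim => n; rewrite /vweight big_nil.
exists u, v; split=> //; apply/funext => x.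
rewrite -(cvg_lim (@Rhausdorff R) (uv x)); apply/esym/cvg_lim => //.
by apply: lim => n; rewrite /vsum big_nil.
Qed.

Lemma continuous_vsum L : continuous (vsum L).
Proof. by have [u [v [us vs ->]]] := vsum_uw_re L; exact: continuous_uw_re. Qed.

Definition convex_ops (C : set 'B(H)) := forall x y t, C x -> C y ->
  0 <= t <= 1 -> C (t%:C *: x + (1 - t)%:C *: y).

(** The family of functions [c |-> vsum L c - vsum L x0] has no common point
    where it is nonnegative, for such a point would be [x0] by
    [vsum_separates]; so [minimax] provides a member that is negative on all
    of [C]. *)
Lemma separation (C : set 'B(H)) x0 : compact C -> C !=set0 -> convex_ops C ->
  ~ C x0 -> exists L m, (forall c, C c -> vsum L c <= m) /\ m < vsum L x0.
Proof.
move=> Cc C0 Cx Cn.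
suff [L hL] : exists L, forall c, C c -> vsum L c < vsum L x0.
  have [|c /set_mem Cc0 cm] := compact_EVT_max (f := vsum L) C0 Cc.
    by apply: continuous_subspaceT; exact: continuous_vsum.
  exists L, (vsum L c); split; last exact: hL.
  by move=> d Cd; apply: cm; exact: mem_set.
apply: contrapT => nL; apply: Cn.
pose Fam := [set h | exists L, h = fun c => vsum L c - vsum L x0].
have [||||c Cc0 cP] := @minimax R _ C Fam Cc C0.
- move=> _ [L ->]; apply: continuous_subspaceT => x.
  apply: (@continuousB _ _ _ (vsum L) (cst (vsum L x0)));
    first exact: continuous_vsum.
  exact: cst_continuous.
- move=> x y t Cx0 Cy t01; exists (t%:C *: x + (1 - t)%:C *: y);
    first exact: Cx.
  by move=> _ [L ->]; rewrite vsumD !vsumZ; ring.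
- move=> _ _ t [L1 ->] [L2 ->] /(vsum_combine L1 L2)[L [LE _]].
  exists (fun c => vsum L c - vsum L x0); first by exists L.
  by move=> x _; rewrite !LE; ring.
- move=> _ [L ->]; apply: contrapT => nh; apply: nL; exists L => c Cc0.
  by rewrite ltNge; apply/negP => h; apply: nh; exists c; rewrite ?subr_ge0.
have -> : x0 = c; last by [].
have le L : vsum L x0 <= vsum L c.
  by rewrite -subr_ge0; apply: (cP (fun c => vsum L c - vsum L x0)); exists L.
by apply/esym; apply: vsum_separates.
Qed.

End Lists.

(** * Operator systems and unital positive maps *)
Lemma adjoint_of_parts (R : realType) (H : hilbertType R) (x y : 'B(H)) :
  selfadjoint H (re_part x y) -> selfadjoint H (im_part x y) -> is_adjoint x y.
Proof.
move=> /saP rs /saP is_; apply/adjointP => u v.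
have := rs u v; have := is_ ('i *: u) v.
rewrite !bopZE !ipZl !ipZr !bopZ ipii ipi ipii.
rewrite !bopDE !bopNE !ipDl !ipDr !ipNl !ipNr; lra.
Qed.

Section OperatorSystems.
Context {R : realType} {H : hilbertType R}.
Implicit Types (x y z : 'B(H)) (M : set 'B(H)) (r : R).

Definition operator_system M :=
  [/\ forall (a : R[i]) x y, M x -> M y -> M (a *: x + y),
      forall x, M x -> exists2 y, M y & is_adjoint x y &
      M (opid H)].

Context {M : set 'B(H)} (HM : operator_system M).

Lemma opsys0 : M 0.
Proof. by have [h _ h1] := HM; have := h (-1) _ _ h1 h1;
  rewrite scaleN1r addNr. Qed.

Lemma opsysD x y : M x -> M y -> M (x + y).
Proof. by have [h _ _] := HM; move=> Mx My; rewrite -[x]scale1r; exact: h. Qed.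

Lemma opsysZ (a : R[i]) x : M x -> M (a *: x).
Proof. by have [h _ _] := HM; move=> Mx; rewrite -[_ *: _]addr0;
  apply: h => //; exact: opsys0. Qed.

Lemma opsysN x : M x -> M (- x).
Proof. by rewrite -scaleN1r; exact: opsysZ. Qed.

Lemma opsysB x y : M x -> M y -> M (x - y).
Proof. by move=> Mx My; apply: opsysD => //; exact: opsysN. Qed.

Lemma opsys_re x y : M x -> M y -> M (re_part x y).
Proof. by move=> Mx My; apply/opsysZ/opsysD. Qed.

Lemma opsys_im x y : M x -> M y -> M (im_part x y).
Proof. by move=> Mx My; apply/opsysZ/opsysZ/opsysB. Qed.

Context {K : hilbertType R}.

Section LinearOn.
Context {f : 'B(H) -> 'B(K)} (fl : linear_on M f).

Lemma linear_on0 : f 0 = 0.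
Proof.
have := fl (-1) opsys0 opsys0.
by rewrite scaler0 addr0 scaleN1r addNr.
Qed.

Lemma linear_onD x y : M x -> M y -> f (x + y) = f x + f y.
Proof. by move=> Mx My; rewrite -[x]scale1r fl// !scale1r. Qed.

Lemma linear_onZ a x : M x -> f (a *: x) = a *: f x.
Proof.
by move=> Mx; rewrite -[a *: x]addr0 fl ?linear_on0 ?addr0//; exact: opsys0.
Qed.

Lemma linear_onN x : M x -> f (- x) = - f x.
Proof. by move=> Mx; rewrite -scaleN1r linear_onZ// scaleN1r. Qed.

Lemma linear_onB x y : M x -> M y -> f (x - y) = f x - f y.
Proof. by move=> Mx My; rewrite linear_onD ?linear_onN//; exact: opsysN. Qed.

Lemma linear_on_re x y : M x -> M y -> f (re_part x y) = re_part (f x) (f y).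
Proof. by move=> Mx My; rewrite linear_onZ ?linear_onD//; exact: opsysD. Qed.

Lemma linear_on_im x y : M x -> M y -> f (im_part x y) = im_part (f x) (f y).
Proof.
move=> Mx My; rewrite linear_onZ ?linear_onZ ?linear_onB//; first exact: opsysB.
by apply/opsysZ/opsysB.
Qed.

End LinearOn.

Context {N : set 'B(K)} {f : 'B(H) -> 'B(K)} (fup : unital_positive M N f).

Lemma up_order x r : M x -> op_ge0 (r%:C *: opid H + x) ->
  op_ge0 (r%:C *: opid K + f x).
Proof.
move=> Mx; have [_ fl f1 fp] := fup; have [_ _ M1] := HM.
by rewrite -f1 -fl//; apply: fp; have [h _ _] := HM; exact: h.
Qed.

Lemma up_sa x : M x -> selfadjoint H x -> selfadjoint K (f x).
Proof.
move=> Mx xs; have [r r0 xr] := bop_bounded x.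
have /(sa_bounded_by_order r0 xs)[_ /(up_order Mx)/op_ge0_sa fs] := xr.
rewrite -[f x](addKr (r%:C *: opid K)).
by apply: saD => //; apply/saN/saZ/sa_opid.
Qed.

Lemma up_bounded x r : M x -> selfadjoint H x -> 0 <= r ->
  bounded_by r x -> bounded_by r (f x).
Proof.
move=> Mx xs r0 /(sa_bounded_by_order r0 xs)[h1 h2].
have [_ fl _ _] := fup.
apply/(sa_bounded_by_order r0 (up_sa Mx xs)); split; last exact: up_order.
by rewrite -(linear_onN fl)//; apply: up_order => //; exact: opsysN.
Qed.

(** The map commutes with real and imaginary parts, which stay selfadjoint. *)
Lemma up_adjoint x y : M x -> M y -> is_adjoint x y -> is_adjoint (f x) (f y).
Proof.
move=> Mx My xy; have [_ fl _ _] := fup.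
apply: adjoint_of_parts; rewrite -?linear_on_re -?linear_on_im//; apply: up_sa.
- exact: opsys_re.
- exact: re_part_sa.
- exact: opsys_im.
- exact: im_part_sa.
Qed.

End OperatorSystems.

Section Iterates.
Context {R : realType} {H : hilbertType R} {M : set 'B(H)} {f : 'B(H) -> 'B(H)}.

Lemma iter_unital_positive n :
  unital_positive M M f -> unital_positive M M (iter n f).
Proof.
move=> [fM fl f1 fp]; elim: n => [|n [gM gl g1 gp]]; first by split.
split=> [x Mx|a x y Mx My||x Mx x0] /=; first exact/fM/gM.
- by rewrite gl// fl//; exact: gM.
- by rewrite g1.
- by apply: fp; [exact: gM|exact: gp].
Qed.

End Iterates.

(** For a unital positive map, which contracts selfadjoint elements by
    [up_bounded], this amounts to being isometric on them. *)
Definition sa_expanding {R : realType} {H K : hilbertType R} (N : set 'B(K))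
    (E : 'B(K) -> 'B(H)) :=
  forall y (c : R), N y -> selfadjoint K y -> 0 <= c ->
    bounded_by c (E y) -> bounded_by c y.

Section InverseUP.
Context {R : realType} {H K : hilbertType R}.
Context {M : set 'B(H)} {N : set 'B(K)} {E : 'B(K) -> 'B(H)}.
Hypotheses (HN : operator_system N) (Eup : unital_positive N M E).

Lemma operator_system_image : operator_system (E @` N).
Proof.
have [EM El E1 Ep] := Eup; have [Nl Nadj N1] := HN; split.
- move=> a _ _ [y Ny <-] [z Nz <-]; exists (a *: y + z); first exact: Nl.
  by rewrite El.
- move=> _ [y Ny <-]; have [y' Ny' yy'] := Nadj y Ny.
  by exists (E y'); [exists y'|exact: up_adjoint Eup _ _ _ _ yy'].
- by exists (opid K).
Qed.

Hypothesis Eiso : sa_expanding N E.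

Let El : linear_on N E. Proof. by case: Eup. Qed.

Lemma expanding_inj y1 y2 : N y1 -> N y2 -> E y1 = E y2 -> y1 = y2.
Proof.
move=> N1 N2 E12.
suff ker y : N y -> E y = 0 -> y = 0.
  apply/subr0_eq/ker; first exact: opsysB.
  by rewrite (linear_onB HN El)// E12 subrr.
move=> Ny Ey; have [_ /(_ y Ny)[y' Ny' yy'] _] := HN.
have Ey' : E y' = 0.
  have := up_adjoint HN Eup Ny Ny' yy'; rewrite Ey => h.
  by apply: (adjoint_uniq h); exact: sa0.
have ker0 (z : 'B(K)) : N z -> selfadjoint K z -> E z = 0 -> z = 0.
  move=> Nz zs Ez; apply: bop_ext => u; apply: rnorm_eq0; apply/eqP.
  rewrite eq_le rnorm_ge0 andbT -(mul0r (rnorm u)).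
  by apply: (Eiso Nz zs (lexx 0)) => w; rewrite Ez rnorm0 mul0r.
have re0 : re_part y y' = 0.
  apply: ker0; [exact: opsys_re|exact: re_part_sa|].
  by rewrite (linear_on_re HN El)// Ey Ey' /re_part addr0 scaler0.
have im0 : im_part y y' = 0.
  apply: ker0; [exact: opsys_im|exact: im_part_sa|].
  by rewrite (linear_on_im HN El)// Ey Ey' /im_part subrr !scaler0.
by rewrite (re_im_part y y') re0 im0 scaler0 addr0.
Qed.

Lemma inv_onK y : N y -> inv_on N E (E y) = y.
Proof.
move=> Ny; apply: pinvKV; last exact/mem_set.
by move=> y1 y2 /set_mem N1 /set_mem N2; exact: expanding_inj.
Qed.

(** If [y] has norm at most [r] and [0 <= E y], then [E (r - y)] has norm at
    most [r], hence so has [r - y], which gives [0 <= y]. *)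
Lemma order_reflecting y : N y -> op_ge0 (E y) -> op_ge0 y.
Proof.
have [EM _ E1 Ep] := Eup; have [Nl Nadj N1] := HN.
move=> Ny Ey0; have Eys := op_ge0_sa Ey0.
have ys : selfadjoint K y.
  have [y' Ny' yy'] := Nadj y Ny; have Eyy' := up_adjoint HN Eup Ny Ny' yy'.
  by have e := expanding_inj Ny Ny' (adjoint_uniq Eys Eyy'); move: yy';
    rewrite -e.
have [r r0 yr] := bop_bounded y.
pose z := r%:C *: opid K - y.
have Nz : N z by apply: opsysB => //; exact: opsysZ.
have zs : selfadjoint K z by apply: saD; [apply/saZ/sa_opid|exact: saN].
have Ez : E z = r%:C *: opid H - E y.
  by rewrite (linear_onB HN El) ?(linear_onZ HN El) ?E1//; exact: opsysZ.
have : bounded_by r (E z).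
  apply/(sa_bounded_by_order r0 (up_sa HN Eup Nz zs)).
  rewrite Ez subKr; split=> //; apply: op_ge0D; first exact: op_ge0_scalar.
  by have /(sa_bounded_by_order r0 Eys)[] := up_bounded HN Eup Ny ys r0 yr.
move=> /(Eiso Nz zs r0)/(sa_bounded_by_order r0 zs)[+ _].
by rewrite subKr.
Qed.

Lemma inv_unital_positive : unital_positive (E @` N) N (inv_on N E).
Proof.
have [EM _ E1 Ep] := Eup; have [Nl Nadj N1] := HN; split.
- by move=> _ [y Ny <-]; rewrite inv_onK.
- move=> a _ _ [y Ny <-] [z Nz <-]; rewrite -El// !inv_onK//; exact: Nl.
- by rewrite -E1 inv_onK.
- by move=> _ [y Ny <-]; rewrite inv_onK//; exact: order_reflecting.
Qed.

End InverseUP.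

(** * Lifting normal functionals through an isometric UP map *)
Section SaBall.
Context {R : realType} {K : hilbertType R} {N : set 'B(K)}.
Hypothesis HN : operator_system N.
Implicit Types (y z : 'B(K)) (r : R).

Lemma sa_ball0 r : 0 <= r -> sa_ball N r 0.
Proof.
move=> r0; split; first by split; [exact: opsys0|exact: sa0].
by move=> u; rewrite bop0E rnorm0 mulr_ge0// rnorm_ge0.
Qed.

Lemma sa_ballN r y : sa_ball N r y -> sa_ball N r (- y).
Proof.
move=> [[Ny ys] yr]; split; first by split; [exact: opsysN|exact: saN].
by move=> u; rewrite bopNE rnormN.
Qed.

Lemma sa_ballZ r c y : sa_ball N r y -> sa_ball N (`|c| * r) (c%:C *: y).
Proof.
move=> [[Ny ys] yr]; split; first by split; [exact: opsysZ|exact: saZ].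
exact: bounded_byZ.
Qed.

Lemma convex_sa_ball r : convex_ops (sa_ball N r).
Proof.
move=> x y t [[Nx xs] xr] [[Ny ys] yr] /andP[t0 t1].
have t1' : 0 <= 1 - t by rewrite subr_ge0.
split; first by split; [apply: opsysD => //; exact: opsysZ|apply: saD;
  exact: saZ].
have := bounded_byD (bounded_byZ t xr) (bounded_byZ (1 - t) yr).
by apply: bounded_by_le; rewrite !ger0_norm// -mulrDl addrC subrK mul1r.
Qed.

End SaBall.

Section Lifting.
Context {R : realType} {H K : hilbertType R}.
Context {N : set 'B(K)} {E : 'B(K) -> 'B(H)}.
Hypotheses (HN : operator_system N) (Ncl : closed N).
Hypotheses (El : linear_on N E) (Ec : {within N, continuous E}).
Hypothesis Eiso : sa_expanding N E.
Implicit Types (y z : 'B(K)) (r s t : R) (g : 'B(K) -> R).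

Local Notation B := (sa_ball N 1).

Lemma within_vsum (C : set 'B(K)) L :
  C `<=` N -> {within C, continuous (vsum L \o E)}.
Proof.
move=> CN y; apply: (@continuous_comp (subspace C) _ _ E (vsum L)).
  exact: (continuous_subspaceW CN Ec).
exact: continuous_vsum.
Qed.

(** Only real scalars: the functionals of interest are real parts. *)
Definition real_linear_on g :=
  (forall y z, N y -> N z -> g (y + z) = g y + g z) /\
  (forall t y, N y -> g (t%:C *: y) = t * g y).

Lemma vsum_real_linear L : real_linear_on (vsum L \o E).
Proof.
split=> [y z Ny Nz|t y Ny] /=; first by rewrite (linear_onD El)// vsumD.
by rewrite (linear_onZ HN El)// vsumZ.
Qed.

Lemma real_linear_bound g s r y : real_linear_on g -> 0 < r ->
  (forall z, B z -> `|g z| <= s) -> sa_ball N r y -> `|g y| <= r * s.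
Proof.
move=> [_ gZ] r0 gs yr.
have /gs : B ((r^-1)%:C *: y).
  have := sa_ballZ HN r^-1 yr.
  by rewrite ger0_norm ?invr_ge0 ?(ltW r0)// mulVf// lt0r_neq0.
have [[Ny _] _] := yr; rewrite gZ// normrM ger0_norm ?invr_ge0 ?(ltW r0)//.
by rewrite ler_pdivrMl.
Qed.

(** If no [L] of weight at most [s] works, then for each of them [g y - s / 2]
    is at least [vsum L (E y)] at some point [y] of the ball, and [minimax]
    makes [y] independent of [L]. As these [L] compute norms, [s * ||E y|| <=
    g y - s / 2], although [g y <= s * ||y|| = s * ||E y||]. *)
Lemma lift_step g s : real_linear_on g -> {within B, continuous g} ->
  0 < s -> (forall y, B y -> `|g y| <= s) ->
  exists2 L, vweight L <= s & forall y, B y -> `|g y - vsum L (E y)| <= s / 2.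
Proof.
move=> glin gc s0 gs; apply: contrapT => nL.
have [gD gZ] := glin; have BN y : B y -> N y by move=> [[]].
have Bc : compact B by exact: compact_sa_ball.
have B0 : B !=set0 by exists 0; exact: sa_ball0.
pose Fam := [set h | exists2 L, vweight L <= s &
                     h = fun y => g y - vsum L (E y) - s / 2].
have [||||y By yP] := @minimax R _ B Fam Bc B0.
- move=> _ [L _ ->] y; apply: cvgB; last exact: cvg_cst.
  by apply: cvgB; [exact: gc|have := @within_vsum B L BN y; exact].
- move=> y z t By Bz t01; exists (t%:C *: y + (1 - t)%:C *: z).
    exact: convex_sa_ball.
  move=> _ [L _ ->].
  have /BN Ny := By; have /BN Nz := Bz.
  have [Ny' Nz'] : N (t%:C *: y) /\ N ((1 - t)%:C *: z) by split; exact: opsysZ.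
  rewrite gD// !gZ// (linear_onD El)// !(linear_onZ HN El)// vsumD !vsumZ; ring.
- move=> _ _ t [L1 w1 ->] [L2 w2 ->] t01;
    have [L [LE wE]] := vsum_combine L1 L2 t01.
  exists (fun y => g y - vsum L (E y) - s / 2); last by move=> y By;
    rewrite LE; ring.
  exists L => //; rewrite wE; move: t01 => /andP[t0 t1]; nra.
- move=> _ [L w ->]; apply: contrapT => nh; apply: nL; exists L => // y By.
  have neg z : B z -> g z - vsum L (E z) <= s / 2.
    move=> Bz; rewrite leNgt; apply/negP => h; apply: nh; exists z => //.
    by rewrite subr_ge0 ltW.
  rewrite ler_norml neg// andbT.
  have /BN Ny := By; have := neg _ (sa_ballN HN By).
  have -> : - y = (-1)%:C *: y by rewrite rmorphN rmorph1 scaleN1r.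
  rewrite gZ// (linear_onZ HN El)// vsumZ; lra.
have {}yP L : vweight L <= s -> vsum L (E y) <= g y - s / 2.
  move=> w; rewrite -subr_ge0.
  have -> : g y - s / 2 - vsum L (E y) = g y - vsum L (E y) - s / 2 by ring.
  by apply: (yP (fun y => g y - vsum L (E y) - s / 2)); exists L.
pose c := (g y - s / 2) / s.
have sc : s * c = g y - s / 2 by rewrite /c mulrC divfK// lt0r_neq0.
have c0 : 0 <= c.
  have := yP [::]; rewrite /vweight /vsum !big_nil -sc => /(_ (ltW s0)).
  by rewrite pmulr_rge0.
have Eyc : bounded_by c (E y).
  by apply: (@vsum_norming _ _ _ s) => // L w; rewrite sc; exact: yP.
have [[Ny ys] _] := By.
have yc := Eiso Ny ys c0 Eyc.
(* The radius has to be positive; it is increased by less than [1 / 2], the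
   gap that is left by the term [s / 2]. *)
have yc' : sa_ball N (c + 4^-1) y.
  by split=> //; apply: bounded_by_le yc; rewrite lerDl invr_ge0.
have := real_linear_bound glin _ gs yc'.
have c4 : 0 < c + 4^-1 by rewrite ltr_wpDl// invr_gt0.
have := ler_norm (g y) => h1 /(_ c4) h2.
move: sc s0; nra.
Qed.

(** The successive differences in [lift_step] are at most [s / 2 ^+ k] on the
    ball, and so are the weights of the lists; these sum up to [2 * s], which
    is the norm bound in the conclusion. *)
Lemma lift_functional g s : real_linear_on g -> {within B, continuous g} ->
  0 < s -> (forall y, B y -> `|g y| <= s) ->
  exists u v, [/\ square_summable u, square_summable v,
    forall y, N y -> selfadjoint K y -> uw_re u v (E y) = g y &
    forall (x : 'B(H)) r, 0 <= r -> bounded_by r x ->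
      `|uw_re u v x| <= 2 * s * r].
Proof.
move=> glin gc s0 gs; have BN y : B y -> N y by move=> [[]].
pose e k : R := s / 2 ^+ k.
have e0 k : 0 < e k by rewrite divr_gt0// exprn_gt0.
pose P k S := forall y, B y -> `|g y - vsum S (E y)| <= e k.
have /choice[st stP] : forall kS : nat * seq (H * H), exists L,
    P kS.1 kS.2 -> vweight L <= e kS.1 /\ P kS.1.+1 (kS.2 ++ L).
  move=> [k S] /=; have [PS|] := pselect (P k S); last by exists [::].
  have [||L Lw LP] :=
    @lift_step (fun y => g y - (vsum S \o E) y) (e k) _ _ (e0 k) PS.
  - have [gD gZ] := glin; have [fD fZ] := vsum_real_linear S.
    split=> [y z Ny Nz|t y Ny]; first by rewrite gD// fD//; ring.
    by rewrite gZ// fZ//; ring.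
  - by move=> y; apply: cvgB; [exact: gc|have := @within_vsum B S BN y; exact].
  exists L => _; split=> // y By; rewrite vsum_cat opprD addrA.
  by have := LP y By; rewrite /e exprSr invfM mulrA.
pose S := fix S k := if k is j.+1 then S j ++ st (j, S j) else [::].
pose Ls k := st (k, S k).
have PS k : P k (S k).
  elim: k => [y By|k IH] /=; last by have [] := stP (k, S k) IH.
  by rewrite /vsum big_nil subr0 /e expr0 divr1 gs.
have wLs k : vweight (Ls k) <= e k by have [] := stP (k, S k) (PS k).
have seriesS x k : series (fun j => vsum (Ls j) x) k = vsum (S k) x.
  elim: k => [|k IH]; first by rewrite /series/= big_geq// /vsum big_nil.
  by rewrite seriesSr IH /= vsum_cat.
have e_geo : e = geometric s (2^-1).
  by apply/funext => k; rewrite /e /geometric/= exprVn.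
have ecvg : series e @ \oo --> s * (1 - 2^-1)^-1.
  by rewrite e_geo; apply: cvg_geometric_series;
    rewrite ger0_norm ?invr_ge0// invf_lt1 ?ltr1n.
have e_le k : series e k <= 2 * s.
  have -> : 2 * s = s * (1 - 2^-1)^-1 by field.
  rewrite -(cvg_lim (@Rhausdorff R) ecvg); apply: nondecreasing_cvgn_le.
    by apply: nondecreasing_series => j _ _; exact: ltW.
  by apply/cvg_ex; eexists; exact: ecvg.
have [|u [v [us vs uvP]]] := @concat_functional _ _ Ls.
  apply: (@series_le_cvg _ _ e) => // [k|k|]; first exact: vweight_ge0.
    exact: ltW.
  by apply/cvg_ex; eexists; exact: ecvg.
have uvB y : B y -> uw_re u v (E y) = g y.
  move=> By; apply/esym; rewrite -(cvg_lim (@Rhausdorff R) (uvP (E y))).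
  apply/esym/cvg_lim => //; apply/cvgrPdist_le => d d0.
  have ec : e @ \oo --> (0 : R).
    by rewrite e_geo; apply: cvg_geometric;
      rewrite ger0_norm ?invr_ge0// invf_lt1 ?ltr1n.
  near=> k; rewrite seriesS; apply: (le_trans (PS k y By)).
  have : `|0 - e k| < d by near: k; move/cvgrPdist_lt: ec; apply.
  by rewrite sub0r normrN => /ltW; apply: le_trans; exact: ler_norm.
exists u, v; split=> // [y Ny ys|x r r0 xr].
  have [r r0 yr] := bop_bounded y.
  have r1 : 0 < r + 1 by rewrite ltr_wpDl.
  have : B ((r + 1)^-1%:C *: y).
    have yr1 : sa_ball N (r + 1) y.
      by split=> //; apply: bounded_by_le yr; rewrite lerDl.
    have := sa_ballZ HN (r + 1)^-1 yr1.
    by rewrite ger0_norm ?invr_ge0 ?(ltW r1)// mulVf// lt0r_neq0.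
  move/uvB; rewrite (linear_onZ HN El)// uw_reZ// glin.2//.
  by apply: mulfI; rewrite invr_eq0 lt0r_neq0.
apply: (cvgr_to_le (cvg_norm (uvP x))); near=> k.
have step k' : `|series (fun j => vsum (Ls j) x) k'| <= r * series e k'.
  elim: k' => [|j IH]; first by rewrite /series/= !big_geq// normr0 mulr0.
  rewrite !seriesSr mulrDr (le_trans (ler_normD _ _))// lerD//.
  by rewrite (le_trans (vsum_le _ r0 xr))// ler_wpM2l.
apply: (le_trans (step k)); rewrite [leRHS]mulrC ler_wpM2l//.
Unshelve. all: by end_near. Qed.

End Lifting.

(** * Closed range and normal inverse *)
(** On a selfadjoint operator [uw_re u v] and [uw_re v u] agree. Their average
    is the continuous functional that evaluates [uw_re u v] at the real part
    of an operator ([uw_re_re]) without naming its adjoint. *)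
Definition uw_sym {R : realType} {L : hilbertType R} (u v : nat -> L)
    (z : 'B(L)) : R :=
  2^-1 * (uw_re u v z + uw_re v u z).

Lemma uw_re_re (R : realType) (L : hilbertType R) (u v : nat -> L)
    (z z' : 'B(L)) :
  square_summable u -> square_summable v -> is_adjoint z z' ->
  uw_re u v (re_part z z') = uw_sym u v z.
Proof.
move=> us vs zz'; rewrite uw_reZ// uw_reD//
  (uw_re_adjoint u v (adjoint_sym zz')) //.
Qed.

Lemma continuous_uw_sym (R : realType) (L : hilbertType R) (u v : nat -> L) :
  square_summable u -> square_summable v -> continuous (uw_sym u v).
Proof.
move=> us vs z; have FF := nbhs_filter z.
by apply: cvgMr; apply: cvgD; exact: continuous_uw_re.
Qed.

Section ClosedRange.
Context {R : realType} {H K : hilbertType R}.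
Context {M : set 'B(H)} {N : set 'B(K)} {E : 'B(K) -> 'B(H)}.
Hypotheses (HM : operator_system M) (Mcl : closed M).
Hypotheses (HN : operator_system N) (Ncl : closed N).
Hypothesis HE : UP_map N M E.
Hypothesis Eiso : sa_expanding N E.
Implicit Types (y : 'B(K)) (x z : 'B(H)).

Let El : linear_on N E. Proof. by case: HE => -[]. Qed.
Let Eup : unital_positive N M E. Proof. by case: HE. Qed.
Let Ec : {within N, continuous E}. Proof. by case: HE. Qed.

Lemma compact_image_sa_ball r : 0 <= r -> compact (E @` sa_ball N r).
Proof.
move=> r0; apply: continuous_compact; last exact: compact_sa_ball.
by apply: continuous_subspaceW Ec => y [[]].
Qed.

Lemma convex_image_sa_ball r : convex_ops (E @` sa_ball N r).
Proof.
move=> _ _ t [y1 y1B <-] [y2 y2B <-] t01.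
exists (t%:C *: y1 + (1 - t)%:C *: y2); first exact: convex_sa_ball.
have [[N1 _] _] := y1B; have [[N2 _] _] := y2B.
rewrite (linear_onD El) ?(linear_onZ HN El)//; exact: opsysZ.
Qed.

Lemma functional_pullback u v : square_summable u -> square_summable v ->
  exists U V, [/\ square_summable U, square_summable V &
    forall y, N y -> selfadjoint K y -> uw_re u v y = uw_re U V (E y)].
Proof.
move=> us vs; pose s := 2^-1 * (sqsum u + sqsum v) + 1.
have sq0 (w : nat -> K) : square_summable w -> 0 <= sqsum w.
  move=> ws; have -> : (0 : R) = series (fun n => rnorm (w n) ^+ 2) 0%N.
    by rewrite /series/= big_geq.
  apply: nondecreasing_cvgn_le => //.
  by apply: nondecreasing_series => n _ _; exact: sqr_ge0.
have s0 : 0 < s.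
  by rewrite /s; have := sq0 _ us; have := sq0 _ vs; lra.
have [||y [_ yr]|U [V [Us Vs UV _]]] :=
  @lift_functional R H K N E HN Ncl El Ec Eiso (uw_re u v) s _ _ s0.
- by split=> *; [exact: uw_reD|exact: uw_reZ].
- by apply: continuous_subspaceT; exact: continuous_uw_re.
- apply: (le_trans (uw_re_le us vs ler01 yr)).
  by rewrite /s div1r lerDl.
by exists U, V; split=> // y Ny ys; rewrite UV.
Qed.

(** Otherwise [separation] gives a list [L] with [vsum L] smaller on the image
    of a large ball than at the real part [a]. By [lift_functional] the
    functional [vsum L \o E] also comes from some [uw_re u v] of small norm.
    Symmetrized, both functionals are continuous and agree on the range of
    [E], hence at [x]; so [vsum L a = uw_re u v a] is too small. *)
Lemma closure_re_part x x' : closure (E @` N) x -> is_adjoint x x' ->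
  exists2 y, N y & E y = re_part x x'.
Proof.
move=> clx xx'; set a := re_part x x'.
have [r r0 ar] := bop_bounded a.
(* The radius is chosen so that [uw_re u v] will be at most half of [m + vsum
   L a] at [a], where [m < vsum L a]. *)
pose r1 := 4 * (r + 1); have r10 : 0 < r1 by rewrite /r1; lra.
apply: contrapT => na.
have aC : ~ (E @` sa_ball N r1) a.
  by move=> [y [[Ny _] _] Ey]; apply: na; exists y.
have C0 : (E @` sa_ball N r1) !=set0.
  by exists (E 0), 0 => //; apply: sa_ball0 => //; exact: ltW.
have [L [m [Cm ma]]] := separation (compact_image_sa_ball (ltW r10)) C0
  (@convex_image_sa_ball r1) aC.
have CE y : sa_ball N r1 y -> vsum L (E y) <= m by move=> yB; apply: Cm;
  exists y.
have m0 : 0 <= m.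
  have := CE 0 (sa_ball0 HN (ltW r10)); rewrite (linear_on0 HN El).
  by rewrite -(scale0r 0) -(rmorph0 (real_complex R)) vsumZ mul0r.
pose A := vsum L a; pose s := (m + A) / r1.
have s0 : 0 < s by rewrite divr_gt0//; rewrite /A; lra.
have fs y : sa_ball N 1 y -> `|vsum L (E y)| <= s.
  have h (z : 'B(K)) : sa_ball N 1 z -> vsum L (E z) <= s.
    move=> zB; have := CE (r1%:C *: z).
    have [[Nz _] _] := zB.
    rewrite (linear_onZ HN El)// vsumZ => h.
    rewrite /s ler_pdivlMr// mulrC (le_trans (h _))//; last by rewrite /A; lra.
    by have := sa_ballZ HN r1 zB; rewrite mulr1 ger0_norm// ltW.
  move=> yB; rewrite ler_norml h// andbT.
  have := h _ (sa_ballN HN yB); have [[Ny _] _] := yB.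
  by rewrite (linear_onN HN El)// -scaleN1r -(rmorphN1 (real_complex R))
    vsumZ mulN1r lerNl.
have [||u [v [us vs uvE uvs]]] :=
  @lift_functional R H K N E HN Ncl El Ec Eiso (vsum L \o E) s _ _ s0 fs.
- exact: vsum_real_linear.
- by apply: (within_vsum Ec) => y [[]].
have [u' [v' [us' vs' LE]]] := vsum_uw_re L.
have eqN z : (E @` N) z -> uw_sym u v z = uw_sym u' v' z.
  move=> [y Ny <-]; have [_ /(_ y Ny)[y' Ny' yy'] _] := HN.
  have Eyy' := up_adjoint HN Eup Ny Ny' yy'.
  rewrite -!(uw_re_re _ _ Eyy')// -(linear_on_re HN El)// -LE uvE//.
    exact: opsys_re.
  exact: re_part_sa.
have eqx : uw_sym u v x = uw_sym u' v' x.
  apply/subr0_eq.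
  have hc : continuous (fun z => uw_sym u v z - uw_sym u' v' z).
    by move=> z; have FF := nbhs_filter z; apply: cvgB;
      exact: continuous_uw_sym.
  have cl0 : closed ((fun z => uw_sym u v z - uw_sym u' v' z) @^-1` [set 0]).
    by apply: closed_comp => [z _|]; [exact: hc|exact: closed_eq].
  suff : ((fun z => uw_sym u v z - uw_sym u' v' z) @^-1` [set 0]) x by [].
  rewrite ((closure_id _).1 cl0); apply: closure_subset clx => z /eqN zz;
    rewrite /= zz; exact: subrr.
have Aa : A = uw_re u v a by rewrite /A LE !(uw_re_re _ _ xx').
have := uvs a r r0 ar; rewrite -Aa ler_norml => /andP[_].
have -> : 2 * s * r = (m + A) / 2 * (r / (r + 1)).
  by rewrite /s /r1; field; lra.
have rr : r / (r + 1) <= 1 by rewrite ler_pdivrMr ?mul1r; lra.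
have rr0 : 0 <= r / (r + 1) by rewrite divr_ge0//; lra.
have : m < A by []. nra.
Qed.

Lemma closed_range : closed (E @` N).
Proof.
apply/closure_id; rewrite eqEsubset; split; first exact: subset_closure.
move=> x clx.
have Mx : M x.
  rewrite ((closure_id M).1 Mcl); apply: closure_subset clx => _ [y Ny <-].
  by have [EM _ _ _] := Eup; exact: EM.
have [_ /(_ x Mx)[x' Mx' xx'] _] := HM.
have [y1 N1 E1] := closure_re_part clx xx'.
have clix : closure (E @` N) (- ('i *: x)).
  have hc : continuous (fun z : 'B(H) => - ('i *: z)).
    move=> z; have FF := nbhs_filter z; apply/cvg_bopP => u v us vs.
    have uw_re_iN w :
        uw_re u v (- ('i *: w)) = - uw_re (fun n => 'i *: u n) v w.
      rewrite -uw_re_i -scaleN1r -(rmorphN1 (real_complex R)) uw_reZ ?mulN1r//.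
    under eq_fun do rewrite uw_re_iN.
    rewrite uw_re_iN; apply: cvgN; apply: continuous_uw_re => //.
    exact: square_summablei.
  move=> V /hc /clx [_ [[y Ny <-] VE]]; exists (- ('i *: E y)); split=> //.
  exists (- ('i *: y)); first by apply: opsysN => //; exact: opsysZ.
  by rewrite (linear_onN HN El) ?(linear_onZ HN El)//; exact: opsysZ.
have ixx' : is_adjoint (- ('i *: x)) ('i *: x').
  move/adjointP: xx' => xx'; apply/adjointP => u v.
  by rewrite bopNE !bopZE ipNl ipi xx' bopZ opprK.
have [y2 N2 E2] := closure_re_part clix ixx'.
exists (y1 + 'i *: y2); first by apply: opsysD => //; exact: opsysZ.
rewrite (linear_onD El) ?(linear_onZ HN El)//; last exact: opsysZ.
rewrite E1 E2 [RHS](re_im_part x x'); congr (_ + 'i *: _).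
by rewrite /re_part /im_part scalerBr addrC.
Qed.

(** Each normal functional on [N], composed with the inverse, is a combination
    of functionals [uw_sym] and [uw_re], by applying [functional_pullback] to
    the real and to the imaginary part of the preimage. *)
Lemma continuous_range_inv : {within E @` N, continuous (inv_on N E)}.
Proof.
apply/subspace_continuousP => x [y Ny <-]; apply/cvg_bopP => u v us vs.
have [U [V [Us Vs UV]]] := functional_pullback us vs.
have [U' [V' [Us' Vs' UV']]] := functional_pullback (square_summablei us) vs.
pose iU' n := 'i *: U' n.
have iUs' : square_summable iU' by exact: square_summablei.
pose G z := uw_sym U V z + 2^-1 * (uw_re V' iU' z - uw_re iU' V' z).
have GE (z : 'B(K)) : N z -> uw_re u v (inv_on N E (E z)) = G (E z).
  move=> Nz; rewrite (inv_onK HN Eup Eiso Nz);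
    have [_ /(_ z Nz)[z' Nz' zz'] _] := HN.
  have Ezz' := up_adjoint HN Eup Nz Nz' zz'.
  rewrite {1}(re_im_part z z') uw_reD// uw_re_i.
  rewrite UV; [|exact: opsys_re|exact: re_part_sa].
  rewrite UV'; [|exact: opsys_im|exact: im_part_sa].
  rewrite (linear_on_re HN El)// (linear_on_im HN El)// uw_re_re//;
    congr (_ + _).
  rewrite uw_reZ// uw_re_i uw_reD// -scaleN1r -(rmorphN1 (real_complex R))
    uw_reZ// mulN1r.
  by rewrite (uw_re_adjoint _ _ (adjoint_sym Ezz')).
have Gc : continuous G.
  move=> z; have FF := nbhs_filter z; apply: cvgD;
    first exact: continuous_uw_sym.
  by apply: cvgMr; apply: cvgB; exact: continuous_uw_re.
rewrite GE//; apply: (@cvg_trans _ (G @ within (E @` N) (nbhs (E y))));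
  last first.
  have FF := nbhs_filter (E y).
  by move=> A hA; apply: cvg_within; exact: (Gc (E y) A hA).
apply: near_eq_cvg; near=> z.
have [w Nw <-] : (E @` N) z by near: z; exact: withinT.
by rewrite GE.
Unshelve. all: by end_near. Qed.

End ClosedRange.

(** * The tail operator system *)
Section HermitianFunctional.
Context {R : realType} {H : hilbertType R} (u v : nat -> H).
Hypotheses (us : square_summable u) (vs : square_summable v).
Implicit Types (x y : 'B(H)) (M : set 'B(H)).

(** The complex-linear functional with real part [uw_sym u v], which turns
    real functionals into elements of the predual. *)
Definition uw_herm x : R[i]^o := uw_sym u v x +i* (- uw_sym u v ('i *: x)).

Lemma uw_symD x y : uw_sym u v (x + y) = uw_sym u v x + uw_sym u v y.
Proof. by rewrite /uw_sym !uw_reD//; ring. Qed.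

Lemma uw_symZ (r : R) x : uw_sym u v (r%:C *: x) = r * uw_sym u v x.
Proof. by rewrite /uw_sym !uw_reZ//; ring. Qed.

Lemma uw_herm_linear (M : set 'B(H)) : linear_on M uw_herm.
Proof.
move=> [a b] x y _ _.
have scE (z : 'B(H)) : (a +i* b) *: z = a%:C *: z + b%:C *: ('i *: z).
  rewrite scalerA -scalerDl; congr (_ *: _); apply/eqP.
  by rewrite eq_complex /= !mul0r !mulr0 !mulr1 subrr add0r !addr0 !eqxx.
have iE : 'i *: ((a +i* b) *: x + y) =
    a%:C *: ('i *: x) + (- b)%:C *: x + 'i *: y.
  rewrite scalerDr scalerA mulrC -scalerA scE scalerA -expr2 sqr_i.
  by rewrite scaleN1r scalerN rmorphN scaleNr.
rewrite /uw_herm iE scE !uw_symD !uw_symZ; apply/eqP; rewrite eq_complex /=.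
by apply/andP; split; apply/eqP; ring.
Qed.

Lemma uw_herm_sa x : selfadjoint H x -> rnorm (uw_herm x) = `|uw_re u v x|.
Proof.
move=> xs; have sym w z : uw_re w z x = uw_re z w x by exact: uw_re_adjoint.
have -> : uw_herm x = (uw_re u v x)%:C.
  rewrite /uw_herm /uw_sym !uw_re_i (sym v u) (sym _ u).
  have -> : uw_re u (fun n => 'i *: v n) x = - uw_re (fun n => 'i *: u n) v x.
    rewrite (_ : - _ = (-1) * uw_re (fun n => 'i *: u n) v x);
      last by rewrite mulN1r.
    apply: cvg_lim => //.
    rewrite (_ : series _ =
      fun n => -1 * series (fun n => ip (x ('i *: u n)) (v n)) n).
      by apply: cvgMr; apply: cvg_uw_re => //; exact: square_summablei.
    apply/funext => n; rewrite /series/= big_distrr/=; apply: eq_bigr => k _.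
    by rewrite bopZ ipi mulN1r opprK.
  apply/eqP; rewrite eq_complex /= subrr mulr0 oppr0 eqxx andbT.
  by apply/eqP; field.
by rewrite /rnorm normc_def /= expr0n addr0 sqrtr_sqr.
Qed.

Lemma continuous_uw_herm : continuous uw_herm.
Proof.
move=> x; have FF := nbhs_filter x; apply/cvg_complexP; split=> /=.
  exact: continuous_uw_sym.
apply: cvgN; rewrite /uw_sym !uw_re_i; under eq_fun do rewrite !uw_re_i.
by apply: cvgMr; apply: cvgD; apply: continuous_uw_re => //;
  exact: square_summablei.
Qed.

End HermitianFunctional.

Section AsymptoticLift.
Context {R : realType} {H K : hilbertType R}.
Context {M : set 'B(H)} {phi : 'B(H) -> 'B(H)}.
Context {N : set 'B(K)} {alpha : 'B(K) -> 'B(K)} {E : 'B(K) -> 'B(H)}.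
Hypotheses (HM : operator_system M) (Mcl : closed M) (Hphi : UP_map M M phi).
Hypotheses (HN : operator_system N) (Ncl : closed N) (HE : UP_map N M E).
Hypothesis Ha : UP_automorphism N alpha.
Hypothesis Ephi : forall y, N y -> E (alpha y) = phi (E y).
Hypothesis Enondeg : nondegenerate_lift N alpha E.
Hypothesis Enorm : forall rho, predual M rho ->
  (fun k => sa_norm M (rho \o iter k phi)) @ \oo --> sa_norm N (rho \o E).

Local Notation beta := (inv_on N alpha).
Local Notation Minf := (tail_system M phi).

Let phiup : unital_positive M M phi. Proof. by case: Hphi. Qed.
Let phic : {within M, continuous phi}. Proof. by case: Hphi. Qed.
Let Eup : unital_positive N M E. Proof. by case: HE. Qed.
Let El : linear_on N E. Proof. by case: Eup. Qed.
Let Ec : {within N, continuous E}. Proof. by case: HE. Qed.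
Let EM y : N y -> M (E y). Proof. by case: Eup => + _ _ _; exact. Qed.
Let aup : unital_positive N N alpha. Proof. by case: Ha => -[]. Qed.
Let bup : unital_positive N N beta. Proof. by case: Ha => _ _ []. Qed.
Let phin_up n : unital_positive M M (iter n phi).
Proof. exact: iter_unital_positive. Qed.
Let bn_up n : unital_positive N N (iter n beta).
Proof. exact: iter_unital_positive. Qed.
Let bnN n y : N y -> N (iter n beta y).
Proof. by case: (bn_up n) => + _ _ _; exact. Qed.

Let alphaK y : N y -> alpha (beta y) = y.
Proof.
by case: Ha => _ [_ _ surj] _ Ny; apply: pinvK; apply/mem_set; exact: surj.
Qed.

Let betaK y : N y -> beta (alpha y) = y.
Proof.
case: Ha => _ [_ inj _] _ Ny; apply: pinvKV; last exact/mem_set.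
exact: inj.
Qed.

Lemma phi_iter_E n y : N y -> iter n phi (E (iter n beta y)) = E y.
Proof.
elim: n y => // n IH y Ny; rewrite iterSr /= -Ephi; last exact: (bnN n.+1).
by rewrite alphaK ?IH//; exact: bnN.
Qed.

(** The functional [rho] separating [x] from the image of the ball has [r *
    ||rho \o E|| < rho x], while [x = phi^k z] with [||z|| <= r] gives [rho x
    <= r * ||rho \o phi^k||] for all [k >= 1]. *)
Lemma tail_sa_in_range x r : 0 < r ->
  (forall n, (0 < n)%N -> (iter n phi @` sa_ball M r) x) ->
  (E @` sa_ball N r) x.
Proof.
move=> r0 xr; apply: contrapT => nx.
have C0 : (E @` sa_ball N r) !=set0.
  by exists (E 0), 0 => //; apply: sa_ball0 => //; exact: ltW.
have [L [m [Cm mx]]] := separation (compact_image_sa_ball Ncl HE (ltW r0)) C0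
  (convex_image_sa_ball HN HE (r := r)) nx.
have [u [v [us vs LE]]] := vsum_uw_re L.
pose rho := uw_herm u v.
have rhoM : predual M rho.
  split; first exact: uw_herm_linear.
  by apply: continuous_subspaceT; exact: continuous_uw_herm.
have ballP (L' : hilbertType R) (Q : set 'B(L')) z :
    (Q `&` selfadjoint L' `&` [set x | opnorm x <= 1]) z <-> sa_ball Q 1 z.
  by split=> -[h1 h2]; split=> //; apply/(opnormP z ler01).
have upper k : r * sa_norm M (rho \o iter k.+1 phi) >= vsum L x.
  have [z [[Mz zs] zr] zx] := xr k.+1 isT.
  have ub : ubound [set rnorm ((rho \o iter k.+1 phi) x) |
      x in M `&` selfadjoint H `&` [set x | opnorm x <= 1]]
      (1 / 2 * (sqsum u + sqsum v)).
    move=> _ [w /ballP[[Mw ws] w1] <-].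
    rewrite /= uw_herm_sa//; last exact: (up_sa HM (phin_up k.+1)).
    by apply: uw_re_le => //; apply: (up_bounded HM (phin_up k.+1)).
  have [_ pl _ _] := phin_up k.+1.
  have r1B : sa_ball M 1 (r^-1%:C *: z).
    have := @sa_ballZ _ _ M HM r r^-1 z.
    by rewrite ger0_norm ?invr_ge0 ?(ltW r0)// mulVf ?lt0r_neq0//; apply.
  rewrite -ler_pdivrMl//;
    apply: (@le_trans _ _ (rnorm (rho (iter k.+1 phi (r^-1%:C *: z))))).
    rewrite (linear_onZ HM pl)// zx uw_herm_sa//; last first.
      by apply: saZ; rewrite -zx; exact: (up_sa HM (phin_up k.+1)).
    by rewrite uw_reZ// -LE ler_norm.
  apply: ub_le_sup; first by exists (1 / 2 * (sqsum u + sqsum v)).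
  by exists (r^-1%:C *: z) => //; apply/ballP.
have lim : vsum L x <= r * sa_norm N (rho \o E).
  have h : (fun k => r * sa_norm M (rho \o iter k phi)) @ \oo -->
      r * sa_norm N (rho \o E).
    by apply: cvgMr; exact: Enorm.
  apply: (cvgr_to_ge h); exists 1%N => // -[//|k] _; exact: upper.
have lower : r * sa_norm N (rho \o E) <= m.
  rewrite -ler_pdivlMl//; apply: ge_sup.
    exists (rnorm ((rho \o E) 0)), 0 => //; apply/ballP.
    exact: sa_ball0.
  have half w : sa_ball N 1 w -> r * uw_re u v (E w) <= m.
    move=> wB; have [[Nw _] _] := wB.
    rewrite -uw_reZ// -(linear_onZ HN El)// -LE; apply: Cm.
    exists (r%:C *: w) => //.
    by have := sa_ballZ HN r wB; rewrite mulr1 ger0_norm// ltW.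
  move=> _ [w /ballP wB <-]; have [[Nw ws] _] := wB.
  rewrite /= uw_herm_sa//; last exact: (up_sa HN Eup).
  rewrite ler_pdivlMl// -{1}(gtr0_norm r0) -normrM ler_norml half// andbT.
  have := half _ (sa_ballN HN wB).
  rewrite (linear_onN HN El)// -scaleN1r -(rmorphN1 (real_complex R)) uw_reZ//.
  lra.
lra.
Qed.

(** The definition of the tail involves all elements of balls, but real and
    imaginary parts of a preimage under [phi^n] are again preimages, of no
    larger norm. In the other direction a bound for both parts of [y] bounds
    every [E (alpha^-n y)]. *)
Lemma tail_systemE : Minf = E @` N.
Proof.
rewrite eqEsubset; split=> [x [r /= r0 xr]|_ [y Ny <-]].
  have [z [Mz zr] zx] := xr 1%N isT.
  have [_ /(_ z Mz)[z' Mz' zz'] _] := HM.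
  set x' := phi z'.
  have xx' : is_adjoint x x' by rewrite -zx; exact: (up_adjoint HM phiup).
  have lift n : (0 < n)%N -> exists w w', [/\ M w, M w', is_adjoint w w',
      bounded_by r w &
      iter n phi w = x /\ iter n phi w' = x'].
    move=> n0; have [w [Mw wr] wx] := xr n n0.
    have [_ /(_ w Mw)[w' Mw' ww'] _] := HM.
    exists w, w'; split=> //; first exact/(opnormP w (ltW r0)).
    split=> //.
    apply: adjoint_uniq xx'; rewrite -wx.
    exact: (up_adjoint HM (phin_up n)).
  have phil n : linear_on M (iter n phi) by case: (phin_up n).
  have [y1 [[N1 _] _] E1] : (E @` sa_ball N r) (re_part x x').
    apply: tail_sa_in_range => // n /lift[w [w' [Mw Mw' ww' wr [wx wx']]]].
    exists (re_part w w'); last by rewrite (linear_on_re HM (phil n))// wx wx'.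
    split; last exact: re_part_bounded (ltW r0) ww' wr.
    by split; [exact: opsys_re|exact: re_part_sa].
  have [y2 [[N2 _] _] E2] : (E @` sa_ball N r) (im_part x x').
    apply: tail_sa_in_range => // n /lift[w [w' [Mw Mw' ww' wr [wx wx']]]].
    exists (im_part w w'); last by rewrite (linear_on_im HM (phil n))// wx wx'.
    split; last exact: im_part_bounded (ltW r0) ww' wr.
    by split; [exact: opsys_im|exact: im_part_sa].
  exists (y1 + 'i *: y2); first by apply: opsysD => //; exact: opsysZ.
  rewrite (linear_onD El) ?(linear_onZ HN El)//; last exact: opsysZ.
  by rewrite E1 E2 -re_im_part.
have [_ /(_ y Ny)[y' Ny' yy'] _] := HN.
have [r r0 yr] := bop_bounded y.
exists (r + r + 1) => /=; first by rewrite ltr_wpDl// addr_ge0.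
move=> n _; exists (E (iter n beta y)); last exact: phi_iter_E.
split; first by apply: EM; exact: bnN.
have [_ bnl _ _] := bn_up n.
have part w : N w -> selfadjoint K w -> bounded_by r w ->
    bounded_by r (E (iter n beta w)).
  move=> Nw ws wr; have ws' := up_sa HN (bn_up n) Nw ws.
  by apply: (up_bounded HN Eup) => //;
    [exact: bnN|exact: (up_bounded HN (bn_up n))].
have Nre := opsys_re HN Ny Ny'; have Nim := opsys_im HN Ny Ny'.
apply/opnormP; first by rewrite !addr_ge0.
apply: (@bounded_by_le _ _ (r + r)); first by rewrite lerDl.
have -> : iter n beta y =
    iter n beta (re_part y y') + 'i *: iter n beta (im_part y y').
  rewrite {1}(re_im_part y y') (linear_onD bnl)//; last exact: opsysZ.
  by rewrite (linear_onZ HN bnl 'i Nim).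
rewrite (linear_onD El); [|exact: bnN|by apply: opsysZ => //; exact: bnN].
rewrite (linear_onZ HN El 'i (bnN n Nim)).
apply: bounded_byD; first by apply: part => //;
  [exact: re_part_sa|exact: re_part_bounded].
by apply: bounded_byi; apply: part => //;
  [exact: im_part_sa|exact: im_part_bounded].
Qed.

Lemma embedsP : embeds N E <-> sa_expanding N E.
Proof.
split=> [emb y c Ny ys c0 /(opnormP _ c0)|Eiso y Ny ys].
  by rewrite emb// => /(opnormP _ c0).
apply/eqP; rewrite eq_le; apply/andP; split.
  apply/opnormP; first exact: opnorm_ge0.
  by apply: (up_bounded HN Eup) => //; [exact: opnorm_ge0|exact: opnorm_bounds].
apply/opnormP; first exact: opnorm_ge0.
by apply: Eiso => //; [exact: opnorm_ge0|exact: opnorm_bounds].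
Qed.

Let aN y : N y -> N (alpha y). Proof. by case: aup => + _ _ _; exact. Qed.
Let bN y : N y -> N (beta y). Proof. by case: bup => + _ _ _; exact. Qed.

(** On the tail, [phi] is the conjugate of [alpha] by the order isomorphism
    [E]. *)
Lemma expanding_tail : sa_expanding N E ->
  closed Minf /\ order_automorphism Minf phi.
Proof.
move=> Eiso; rewrite tail_systemE; have Einj := expanding_inj HN Eup Eiso.
split; first exact: closed_range HM Mcl HN Ncl HE Eiso.
have [phiM phil phi1 phip] := phiup; have [_ al a1 ap] := aup;
  have [_ bl b1 bp] := bup.
have [_ _ E1 Ep] := Eup; have [Nl _ N1] := HN.
have phiE y : N y -> phi (E (beta y)) = E y.
  by move=> Ny; rewrite -Ephi ?alphaK//; exact: bN.
have phiinj : set_inj (E @` N) phi.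
  move=> _ _ /set_mem[y1 Ny1 <-] /set_mem[y2 Ny2 <-]; rewrite -!Ephi// => e.
  congr E; rewrite -(betaK Ny1) -(betaK Ny2); congr beta.
  by apply: Einj e; exact: aN.
have invE y : N y -> inv_on (E @` N) phi (E y) = E (beta y).
  move=> Ny; rewrite -(phiE y Ny); apply: pinvKV => //.
  by apply/mem_set; exists (beta y) => //; exact: bN.
have Esub x : (E @` N) x -> M x by move=> [y Ny <-]; exact: EM.
split; split.
- by move=> _ [y Ny <-]; exists (alpha y); [exact: aN|exact: Ephi].
- by move=> a x y /Esub Mx /Esub My; exact: phil.
- exact: phi1.
- by move=> x /Esub; exact: phip.
- by move=> _ [y Ny <-]; exists (alpha y); [exact: aN|exact: Ephi].
- exact: phiinj.
- by move=> _ [y Ny <-]; exists (E (beta y)); [exists (beta y) => //;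
    exact: bN|exact: phiE].
- by move=> _ [y Ny <-]; rewrite invE//; exists (beta y) => //; exact: bN.
- move=> a _ _ [y Ny <-] [z Nz <-]; rewrite -El// !invE//; last exact: Nl.
  by rewrite bl// El//; exact: bN.
- by rewrite -E1 invE// b1.
- move=> _ [y Ny <-] Ey0; rewrite invE//.
  apply: Ep; first exact: bN.
  by apply: bp => //; exact: (order_reflecting HN Eup Eiso).
Qed.

Lemma opsys_tail : operator_system Minf.
Proof. by rewrite tail_systemE; exact: (operator_system_image HN Eup). Qed.

Lemma tail_sub x : Minf x -> M x.
Proof. by rewrite tail_systemE => -[y Ny <-]; exact: EM. Qed.

Section OrderAutomorphism.
Hypothesis phiord : order_automorphism Minf phi.

Local Notation psi := (inv_on Minf phi).
Let phi_inj : set_inj Minf phi. Proof. by case: phiord => _ []. Qed.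
Let psi_up : unital_positive Minf Minf psi. Proof. by case: phiord. Qed.
Let psin_up n : unital_positive Minf Minf (iter n psi).
Proof. exact: iter_unital_positive. Qed.

Let phi_psi x : Minf x -> phi (psi x) = x.
Proof. by move=> Mx; apply: pinvK; apply/mem_set; case: phiord => _ [_ _ +] _;
  exact. Qed.

Let phin_psin n x : Minf x -> iter n phi (iter n psi x) = x.
Proof.
elim: n x => // n IH x Mx; rewrite iterSr /= phi_psi ?IH//.
by have [h _ _ _] := psin_up n; exact: h.
Qed.

(** If [E y = 0] then [phi] kills successively all the tail elements [E
    (alpha^-n y)]; being injective on the tail, it forces them to vanish, and
    the lift is nondegenerate. *)
Lemma order_automorphism_inj y1 y2 : N y1 -> N y2 -> E y1 = E y2 -> y1 = y2.
Proof.
move=> N1 N2 E12; apply/subr0_eq; apply: Enondeg; first exact: opsysB.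
move=> n; set y := y1 - y2; have Ny : N y by exact: opsysB.
have Ey : E y = 0 by rewrite /y (linear_onB HN El)// E12 subrr.
have M0 : Minf 0 by exact: opsys0 opsys_tail.
have Mn k : Minf (E (iter k beta y)).
  by rewrite tail_systemE; exists (iter k beta y) => //; exact: bnN.
elim: n => // n IH; apply: phi_inj; try exact/mem_set.
have [_ phil _ _] := phiup.
rewrite (linear_on0 HM phil) -Ephi; last exact: (bnN n.+1).
by rewrite /= alphaK// ; exact: bnN.
Qed.

(** The inverse of [phi] on the tail is unital and positive, hence contractive
    on selfadjoint elements: [E y] is in [phi^n (ball_r M^sa)] for all [n] as
    soon as its norm is at most [r], so [E y = E y'] for some [y'] in the ball
    of radius [r] of [N]. *)
Lemma order_automorphism_expanding : sa_expanding N E.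
Proof.
move=> y c Ny ys c0 Eyc.
have Mx : Minf (E y) by rewrite tail_systemE; exists y.
have large r : 0 < r -> c <= r -> bounded_by r y.
  move=> r0 cr; have Eyr : bounded_by r (E y) by exact: bounded_by_le Eyc.
  suff [y' [[Ny' _] y'r] /(order_automorphism_inj Ny' Ny) <- //] :
      (E @` sa_ball N r) (E y).
  apply: tail_sa_in_range => // n _; exists (iter n psi (E y));
    last exact: phin_psin.
  have Eys := up_sa HN Eup Ny ys.
  split; last exact: (up_bounded opsys_tail (psin_up n) Mx Eys (ltW r0)).
  split; last exact: (up_sa opsys_tail (psin_up n)).
  by apply: tail_sub; have [h _ _ _] := psin_up n; exact: h.
move=> u; apply/ler_addgt0Pl => e e0.
have u1 : 0 < rnorm u + 1 by have := rnorm_ge0 u; lra.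
have de : 0 < e / (rnorm u + 1) by exact: divr_gt0.
have := large (c + e / (rnorm u + 1)) _ _ u.
rewrite lerDl (ltW de) ltr_wpDl// => /(_ isT isT) /le_trans; apply.
rewrite mulrDl addrC lerD2r.
rewrite mulrAC ler_pdivrMr// ler_pM2l//; lra.
Qed.

End OrderAutomorphism.

(** Normality of the inverses of [phi] and of [E] comes from
    [continuous_range_inv], as both are isometric on selfadjoint elements. *)
Lemma tail_isomorphic : closed Minf -> order_automorphism Minf phi ->
  reversible_lift M phi Minf phi idfun /\
  isomorphic_triples N alpha E Minf phi idfun.
Proof.
move=> clM phiord; have [phi_up [phiS phi_inj phi_surj] psi_up] := phiord.
have Eiso := order_automorphism_expanding phiord.
have Einj := order_automorphism_inj phiord.
have HMinf := opsys_tail.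
have subM : Minf `<=` M by exact: tail_sub.
have phiUP : UP_map Minf Minf phi.
  by split=> //; exact: continuous_subspaceW subM phic.
have psic : {within Minf, continuous (inv_on Minf phi)}.
  have im : phi @` Minf = Minf.
    by rewrite eqEsubset; split=> // _ [x Mx <-]; exact: phiS.
  suff : {within phi @` Minf, continuous (inv_on Minf phi)} by rewrite im.
  apply: (continuous_range_inv HMinf clM phiUP).
  move=> x c Mx xs c0 phixc.
  have Mphix : Minf (phi x) by exact: phiS.
  rewrite -[x](_ : inv_on Minf phi (phi x) = x).
    apply: (up_bounded HMinf psi_up) => //.
    exact: (up_sa HMinf phi_up).
  by apply: pinvKV => //; exact/mem_set.
split; first split.
- by case: HMinf => *; split.
- by split.
- split; last by apply: continuous_subspaceT => x; exact: cvg_id.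
  by split=> //; exact: subM.
- by [].
have EMinf : set_fun N Minf E by rewrite tail_systemE => y Ny; exists y.
exists E; split=> //; split.
- by split=> //; have [_ ? ? ?] := Eup; split.
- split=> //; first by move=> y1 y2 /set_mem ? /set_mem ?; exact: Einj.
  by rewrite tail_systemE.
- rewrite tail_systemE; split; first exact: (inv_unital_positive HN Eup Eiso).
  exact: (continuous_range_inv HN Ncl HE Eiso).
Qed.

End AsymptoticLift.

Theorem theorem3p3 (R : realType) (H : hilbertType R) (M : set 'B(H))
    (phi : 'B(H) -> 'B(H)) (HM : dual_operator_system M)
    (Hphi : UP_map M M phi)
    (K : hilbertType R) (N : set 'B(K)) (alpha : 'B(K) -> 'B(K))
    (E : 'B(K) -> 'B(H)) (HN : asymptotic_lift M phi N alpha E) :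
  let Minf := tail_system M phi in
  let i := embeds N E in
  let ii := closed Minf /\ order_automorphism Minf phi in
  let iii := reversible_lift M phi Minf phi idfun /\
             isomorphic_triples N alpha E Minf phi idfun in
  (i <-> ii) /\ (ii <-> iii).
Proof.
move=> Minf i ii iii.
have [[[Nl Nadj N1 Ncl] Ha HE Ephi] Enondeg Enorm] := HN.
have [Ml Madj M1 Mcl] := HM.
have sysM : operator_system M by split.
have sysN : operator_system N by split.
have iP : i <-> sa_expanding N E by exact: embedsP sysN HE.
split; split.
- by move=> /iP;
    exact: (expanding_tail sysM Mcl Hphi sysN Ncl HE Ha Ephi Enorm).
- move=> [_ phiord]; apply/iP.
  exact: (order_automorphism_expanding sysM Hphi sysN Ncl HE Ha Ephi
    Enondeg Enorm).
- move=> [cl phiord].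
  exact: (tail_isomorphic sysM Hphi sysN Ncl HE Ha Ephi Enondeg Enorm).
- move=> [[[_ _ _ cl] [[phiup _] phibij [psiup _]] _ _] _].
  by split.
Qed.
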